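(* Let $c>0$ and assume that $f\in L^2(\mathbb{R})$ is $\varepsilon_T$-concentrated to $(-1,1)$ and $\varepsilon_\Omega$-concentrated (in frequency) to $(-c,c)$, that is, $$\int_{|t|>1}|f(t)|^2\,\mathrm{d}t\leq\varepsilon_T^2\|f\|_{L^2(\mathbb{R})}^2\quad\text{and}\quad\int_{|\omega|>c}|\widehat f(\omega)|^2\,\mathrm{d}\omega\leq\varepsilon_\Omega^2\|f\|_{L^2(\mathbb{R})}^2,$$ where $\varepsilon_T,\varepsilon_\Omega>0$. Then, for every integer $N\geq ec/2$, $$\|f-\mathcal{L}_Nf\|_{L^2(-1,1)}\leq\left(2\varepsilon_\Omega+\sqrt{c}\left(\frac{ec}{2N+5}\right)^{N+1}\right)\|f\|_{L^2(\mathbb{R})}$$ and $$\|f-\mathcal{L}_Nf\|_{L^2(\mathbb{R})}\leq\left(\varepsilon_T+2\varepsilon_\Omega+\sqrt{c}\left(\frac{ec}{2N+5}\right)^{N+1}\right)\|f\|_{L^2(\mathbb{R})}.$$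
   Context: The Fourier transform is normalized by $\widehat{f}(\omega)=\frac{1}{\sqrt{2\pi}}\int_{\mathbb{R}}f(t)e^{-it\omega}\,\mathrm{d}t$ for $f\in L^1(\mathbb{R})$ (extended to $L^2(\mathbb{R})$ as usual). $P_k$ is the classical Legendre polynomial of degree $k$ with $P_k(1)=1$, and $\tilde P_k=\sqrt{k+1/2}\,P_k$, so that $(\tilde P_k)_{k\geq 0}$ is an orthonormal basis of $L^2([-1,1])$. For $f\in L^2(\mathbb{R})$, $\mathcal{L}_Nf=\sum_{k=0}^{N}\langle \mathbf{1}_{(-1,1)}f,\tilde P_k\rangle\,\tilde P_k\mathbf{1}_{(-1,1)}$ (a function on $\mathbb{R}$ vanishing outside $(-1,1)$), the inner product being that of $L^2([-1,1])$. *)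

(* Defs.v *)
From HB Require Import structures.
From mathcomp Require Import all_boot all_order all_algebra.
From mathcomp Require Import all_classical all_reals all_analysis.
From mathcomp Require Export complex.

Set Implicit Arguments.
Unset Strict Implicit.
Unset Printing Implicit Defensive.

Import Order.TTheory GRing.Theory Num.Theory numFieldNormedType.Exports.

Local Open Scope classical_set_scope.
Local Open Scope ring_scope.
Local Open Scope complex_scope.

Section ComplexLebesgue.
Context {R : realType}.
Implicit Types (D : set R) (f g : R -> R[i]).

Definition cmodulus (z : R[i]) : R := ComplexField.Normc.normc z.

(* f : R -> C belongs to L^p iff its real and imaginary parts do *)
Definition memLp (p : \bar R) f : Prop :=
  (@complex.Re R \o f \in Lfun (@lebesgue_measure R) p) /\
  (@complex.Im R \o f \in Lfun (@lebesgue_measure R) p).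

Definition L2norm D f : \bar R :=
  'N[@lebesgue_measure R]_(2%:E)[(fun t => (cmodulus (f t))%:E) \_ D]%E.

Definition cintegral D f : R[i] :=
  (\int[lebesgue_measure]_(t in D) @complex.Re R (f t)) +i*
  (\int[lebesgue_measure]_(t in D) @complex.Im R (f t)).

(* e^{ix} *)
Definition cis (x : R) : R[i] := cos x +i* sin x.

Definition fourier f (w : R) : R[i] :=
  (Num.sqrt (2 * pi))^-1%:C * cintegral setT (fun t => f t * cis (- (t * w))).

(* The graph of the L^2 Fourier transform: the closure in L^2 x L^2 of the
   graph of [fourier] on L^1 `&` L^2. It determines fhat up to a.e. equality. *)
Definition is_fourierL2 f (fhat : R -> R[i]) : Prop :=
  [/\ memLp 2%:E f, memLp 2%:E fhat &
    exists h : nat -> R -> R[i],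
      [/\ forall n, memLp 1%:E (h n) /\ memLp 2%:E (h n),
          (L2norm setT (f \- h n)%R @[n --> \oo] --> (0 : \bar R))%E &
          (L2norm setT (fhat \- fourier (h n))%R @[n --> \oo]
             --> (0 : \bar R))%E]].

End ComplexLebesgue.

Section Legendre.
Variable R : realType.

(* Rodrigues' formula; normalised so that P_k(1) = 1 *)
Definition legendre (k : nat) : {poly R} :=
  (2 ^+ k * k`!%:R)^-1 *: derivn k (('X^2 - 1) ^+ k).

Definition legendreN (k : nat) (t : R) : R[i] :=
  (Num.sqrt (k%:R + 2^-1) * (legendre k).[t])%:C.

(* inner product of L^2([-1, 1]) *)
Definition inner11 (f g : R -> R[i]) : R[i] :=
  cintegral `[-1, 1] (fun t => f t * conjc (g t)).

Definition ind11 (t : R) : R[i] := (\1_(`]-1, 1[%classic : set R) t)%:C.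

Definition legendre_proj (N : nat) (f : R -> R[i]) (t : R) : R[i] :=
  \sum_(0 <= k < N.+1)
    inner11 (fun s => ind11 s * f s) (legendreN k) * (legendreN k t * ind11 t).

End Legendre.

(* Main.v *)
Require Import Defs.
From mathcomp Require Import all_boot all_order all_algebra.
From mathcomp Require Import all_classical all_reals all_analysis.
From mathcomp Require Import measurable_realfun zify ring lra.
Import Order.TTheory GRing.Theory Num.Theory numFieldNormedType.Exports.
Local Open Scope classical_set_scope.
Local Open Scope ring_scope.

(** Put n = N + 1 and let g be f - L_N f restricted to [-1, 1]: it is orthogonal
    to all polynomials of degree < n, and <f, g> = |g|^2. By Parseval,
    |g|^2 = <f^, g^>; the frequencies |w| > c contribute at most epsO |f| |g|. For
    |w| <= c, g^(w) only sees the component of t |-> e^{itw} orthogonal to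
    P_0, ..., P_N, whose squared norm is the sum over k >= n of squared Legendre
    coefficients of e^{itw}. Rodrigues' formula and k integrations by parts bound
    the k-th one by (k + 1/2) (b_k w^k)^2 with b_k = 2 / (1 3 5 ... (2k + 1)); since
    |w| <= c <= n these terms decay at least like 4^{-k}, and integrating the n-th
    one over [-c, c] produces sqrt c (ec / (2N + 5))^{N+1}. (The factor 2 in front
    of epsO is not sharp.)

    Parseval for compactly supported g is obtained from the Abel weights
    e^{-e|w|}, whose Fourier transform is the Poisson kernel p_e: the identity
    \iint (a(s) - a(t))^2 p_e(s - t) ds dt =
      4 pi |a|^2 - 2 \int e^{-e|w|} (cosT a w ^ 2 + sinT a w ^ 2) dw
    gives Bessel's inequality as e -> 0, and equality when a is Lipschitz; the
    general case follows by density. *)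

(** * Real square integrable functions *)

(** The relation [is_fourierL2] presents [fhat] only as an L^2 limit of transforms of integrable
    functions. Parseval between [fhat] and the transform of g is therefore proved for the
    approximants, by polarizing at g, where Bessel's inequality is an equality because g has compact
    support; Cauchy-Schwarz then carries it to the limit. The analysis is done on real functions: a
    complex transform is assembled from cosine and sine transforms of real and imaginary parts, and
    Hermitian products are replaced by their real part, which is enough since <f, g> = |g|^2 is
    real. Legendre expansions are summed for cos(tw) and sin(tw) alone, where uniform Taylor
    approximation on [-1, 1] controls the remainder. Constants: 2N + 5 is 2n + 3, and N >= ec/2 with
    e >= 2 gives c <= n. For n >= 1 one has b_n (2n + 3)^n <= (5/3) e^n. With the geometric factor
    4/3 and 1/(2 pi) <= 1/4, the product (1/4)(4/3)(25/9) = 25/27 stays below 1, so the final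
    estimate carries no extra constant. *)

Section RealL2.
Context {R : realType}.
Notation mu := (@lebesgue_measure R).
Implicit Types (a b k : R -> R) (D : set R) (r : R).

Definition L1 a := mu.-integrable setT (EFin \o a).
Definition L2 a := measurable_fun setT a /\ L1 (fun x => a x ^+ 2).

Lemma L1_measurable a : L1 a -> measurable_fun setT a.
Proof. by move/measurable_int/measurable_EFinP. Qed.

Lemma L1_le a b : measurable_fun setT a -> L1 b ->
  (forall x, `|a x| <= b x) -> L1 a.
Proof.
move=> ma ib ab; apply: (le_integrable measurableT _ _ ib) => /=.
  exact/measurable_EFinP.
by move=> x _ /=; rewrite lee_fin (le_trans (ab x))// ler_norm.
Qed.

Lemma L1D a b : L1 a -> L1 b -> L1 (fun x => a x + b x).
Proof. by move=> ia ib; have := integrableD measurableT ia ib. Qed.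

Lemma L1Z r a : L1 a -> L1 (fun x => r * a x).
Proof. by move=> ia; have := integrableZl measurableT r ia. Qed.

Lemma L1N a : L1 a -> L1 (fun x => - a x).
Proof. by move=> ia; have := integrableN ia. Qed.

Lemma L1B a b : L1 a -> L1 b -> L1 (fun x => a x - b x).
Proof. by move=> ia ib; apply: L1D => //; exact: L1N. Qed.

Lemma L1_norm a : L1 a -> L1 (fun x => `|a x|).
Proof. by move=> ia; have := integrable_norm ia. Qed.

Lemma L1Mb a k r : L1 a -> measurable_fun setT k -> (forall x, `|k x| <= r) ->
  L1 (fun x => a x * k x).
Proof.
move=> ia mk kr; apply: (L1_le _ (fun x => r * `|a x|)).
- by apply: measurable_funM => //; exact: L1_measurable.
- by apply: L1Z; exact: L1_norm.
- by move=> x; rewrite normrM mulrC ler_wpM2r.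
Qed.

Lemma integralD' a b : L1 a -> L1 b ->
  \int[mu]_x (a x + b x) = \int[mu]_x a x + \int[mu]_x b x.
Proof. by move=> ia ib; rewrite RintegralD. Qed.

Lemma integralB' a b : L1 a -> L1 b ->
  \int[mu]_x (a x - b x) = \int[mu]_x a x - \int[mu]_x b x.
Proof. by move=> ia ib; rewrite RintegralB. Qed.

Lemma integralZ' r a : L1 a -> \int[mu]_x (r * a x) = r * \int[mu]_x a x.
Proof. by move=> ia; rewrite RintegralZl. Qed.

Lemma integral_le' a b : L1 a -> L1 b -> (forall x, a x <= b x) ->
  \int[mu]_x a x <= \int[mu]_x b x.
Proof. by move=> ia ib ab; apply: le_Rintegral. Qed.

Lemma integral_indic' D a : measurable D ->
  \int[mu]_(x in D) a x = \int[mu]_x (\1_D x * a x).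
Proof.
move=> mD; rewrite Rintegral_mkcond; congr Rintegral; apply/funext => x.
by rewrite patchE indicE; case: (x \in D); rewrite ?mul1r ?mul0r.
Qed.

Lemma EFin_integral a : L1 a ->
  ((\int[mu]_x a x)%:E = \int[mu]_x (a x)%:E)%E.
Proof. by move=> ia; rewrite fineK//; exact: integrable_fin_num. Qed.

Lemma L2_measurable a : L2 a -> measurable_fun setT a. Proof. by case. Qed.

Lemma L2_sqr a : L2 a -> L1 (fun x => a x ^+ 2). Proof. by case. Qed.

Lemma L2_le a b : measurable_fun setT a -> L2 b ->
  (forall x, `|a x| <= `|b x|) -> L2 a.
Proof.
move=> ma [mb ib] ab; split => //; apply: (L1_le _ _ _ ib).
  exact: measurable_funX.
by move=> x; rewrite normrX -[leRHS](real_normK (num_real _)) lerXn2r// nnegrE.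
Qed.

Lemma L2Z r a : L2 a -> L2 (fun x => r * a x).
Proof.
case=> ma ia; split; first exact: measurable_funM.
by under eq_fun do rewrite exprMn; exact: L1Z.
Qed.

Lemma L2D a b : L2 a -> L2 b -> L2 (fun x => a x + b x).
Proof.
case=> ma ia [mb ib]; have mab := measurable_funD ma mb; split => //.
apply: (L1_le _ (fun x => 2 * a x ^+ 2 + 2 * b x ^+ 2)).
- exact: measurable_funX.
- by apply: L1D; exact: L1Z.
- move=> x; rewrite ger0_norm ?sqr_ge0// -subr_ge0.
  by rewrite (_ : _ - _ = (a x - b x) ^+ 2) ?sqr_ge0//; ring.
Qed.

Lemma L2N a : L2 a -> L2 (fun x => - a x).
Proof. by move=> /(L2Z (-1)); under eq_fun do rewrite mulN1r. Qed.

Lemma L2B a b : L2 a -> L2 b -> L2 (fun x => a x - b x).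
Proof. by move=> ia ib; apply: L2D => //; exact: L2N. Qed.

Lemma L2M a b : L2 a -> L2 b -> L1 (fun x => a x * b x).
Proof.
move=> [ma ia] [mb ib]; apply: (L1_le _ (fun x => a x ^+ 2 + b x ^+ 2)).
- exact: measurable_funM.
- exact: L1D.
- move=> x; rewrite normrM -(real_normK (num_real (a x))) -(real_normK (num_real (b x))).
  have := sqr_ge0 (`|a x| - `|b x|); have := normr_ge0 (a x).
  have := normr_ge0 (b x); nra.
Qed.

Lemma L2Mb a k r : L2 a -> measurable_fun setT k -> (forall x, `|k x| <= r) ->
  L2 (fun x => a x * k x).
Proof.
move=> ia mk kr; apply: (L2_le _ (fun x => r * a x)).
- by apply: measurable_funM => //; exact: L2_measurable.
- exact: L2Z.
- by move=> x; rewrite !normrM mulrC ler_wpM2r// (le_trans (kr x))// ler_norm.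
Qed.

Lemma L2_indic a D : measurable D -> L2 a -> L2 (fun x => \1_D x * a x).
Proof.
move=> mD ia; rewrite (_ : (fun x => _) = fun x => a x * \1_D x); last first.
  by apply/funext => x; rewrite mulrC.
apply: (@L2Mb _ _ 1) => // x.
by rewrite indicE; case: (x \in D); rewrite ?normr1 ?normr0.
Qed.

Lemma L1_indic_itv (x y : R) : L1 (\1_(`[x, y]%classic)).
Proof. exact: (integrable_indic_itv x y true false). Qed.

Lemma L2_indic_itv (x y : R) : L2 (\1_(`[x, y]%classic)).
Proof.
split; first exact: measurable_indic.
rewrite (_ : (fun x => _) = \1_(`[x, y]%classic)); first exact: L1_indic_itv.
apply/funext => z; rewrite indicE; by case: (_ \in _); rewrite ?expr1n ?expr0n.
Qed.

Lemma bounded_itv_L2 a (x y : R) r : measurable_fun setT a ->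
  (forall z, `|a z| <= r) -> (forall z, z \notin `[x, y] -> a z = 0) -> L2 a.
Proof.
move=> ma ar a0; apply: (L2_le _ (fun z => r * \1_(`[x, y]%classic) z)) => //.
  exact/L2Z/L2_indic_itv.
move=> z; rewrite indicE mem_setE; case: (boolP (z \in `[x, y])) => [_|/a0 ->].
  by rewrite mulr1 (le_trans (ar z))// ler_norm.
by rewrite normr0.
Qed.

Lemma L2_itv_L1 a (x y : R) : L2 a ->
  (forall z, z \notin `[x, y] -> a z = 0) -> L1 a.
Proof.
move=> ia a0; have := L2M _ _ ia (L2_indic_itv x y).
rewrite (_ : (fun z => _) = a)//; apply/funext => z.
rewrite indicE mem_setE; case: (boolP (z \in `[x, y])) => [_|/a0 ->].
  by rewrite mulr1.
by rewrite mul0r.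
Qed.

(** Serves three times: Cauchy-Schwarz in complex L^2, Cauchy-Schwarz with a weight on [-1, 1], and
    polarization of the Plancherel defect at one of its zeros. *)
Lemma discriminant_le (x y z : R) :
  (forall t, 0 <= x + 2 * t * y + t ^+ 2 * z) -> y ^+ 2 <= x * z.
Proof.
move=> h; have x0 : 0 <= x by have := h 0; rewrite !(mulr0, mul0r, expr0n, addr0).
have [z0|z0] := eqVneq z 0.
  have [->|y0] := eqVneq y 0; first by rewrite z0 expr0n mulr0.
  (* At this point the affine function takes the value x - (x + 1) = -1. *)
  have := h (- (x + 1) / (2 * y)).
  rewrite z0 mulr0 addr0 (_ : 2 * _ * y = - (x + 1)); last by field.
  by rewrite opprD addrA subrr add0r oppr_ge0 lt_geF.
have zp : 0 < z.
  rewrite lt_neqAle eq_sym z0 /=; rewrite leNgt; apply/negP => zn.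
  (* For z < 0 the two points v + u and v - u are chosen so that the terms in uv cancel: the values
     add up to 2 (x + u^2 z), which is negative since u >= 1 and u z = z - (x + 1). *)
  have := h (- (2 * y) / z + (- (x + 1) / z + 1)).
  have := h (- (2 * y) / z - (- (x + 1) / z + 1)).
  set u := - (x + 1) / z + 1; set v := - (2 * y) / z.
  have -> : y = - v * z / 2 by rewrite /v; field.
  have uz : u * z = - (x + 1) + z by rewrite /u; field.
  have u1 : 1 <= u by rewrite lerDr mulr_le0 ?invr_le0 ?ltW//; lra.
  have : u * u * z <= u * z.
    by rewrite -mulrA ler_neMl// nmulr_lle0//; lra.
  nra.
have := h (- y / z).
rewrite (_ : _ + _ = (x * z - y ^+ 2) / z); last by field.
by rewrite pmulr_lge0 ?invr_gt0// subr_ge0.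
Qed.

End RealL2.

(** * Poisson kernel *)

Section Poisson.
Context {R : realType}.
Notation mu := (@lebesgue_measure R).
Implicit Types e u s t w : R.

Lemma is_derive_cvg (F : R -> R) (x l : R) :
  is_derive x (1 : R) F l -> F y @[y --> x] --> F x.
Proof. by case=> dF _; exact/differentiable_continuous/derivable1_diffP. Qed.

Lemma lebesgue_measure_shift (s : R) (A : set R) : measurable A ->
  pushforward mu (fun t : R => t + s : measurableTypeR R) A = mu A.
Proof.
move=> mA; apply/esym/lebesgue_measure_unique => //=.
  by apply: measurable_funD.
move=> ? _ [[a b]] _ <-; rewrite /pushforward.
rewrite (_ : _ @^-1` _ = `]a - s, b - s]%classic).
  rewrite !lebesgue_measure_itv/= !lte_fin ltrD2r.
  by case: ifP => // _; rewrite -!EFinB; congr EFin; ring.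
by apply/seteqP; split => x /=; rewrite !in_itv/= ltrBlDr lerBrDr.
Qed.

Lemma ge0_integral_shift (f : R -> \bar R) (s : R) :
  measurable_fun [set: R] f -> (forall r, 0 <= f r)%E ->
  (\int[mu]_t f (t + s)%R = \int[mu]_t f t)%E.
Proof.
move=> mf f0; transitivity (\int[pushforward mu (fun t : R => t + s : measurableTypeR R)%R]_t f t)%E.
  by rewrite ge0_integral_pushforward//=; exact: measurable_funD.
apply: eq_measure_integral => /=; first exact: measurable_funD.
by move=> mshift A mA _; rewrite -(lebesgue_measure_shift s).
Qed.

Definition poisson (e u : R) : R := 2 * e / (e ^+ 2 + u ^+ 2).

Lemma poisson_ge0 e u : 0 < e -> 0 <= poisson e u.
Proof. by move=> e0; rewrite divr_ge0 ?mulr_ge0 ?addr_ge0 ?sqr_ge0// ltW. Qed.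

Lemma poissonN e u : poisson e (- u) = poisson e u. Proof. by rewrite /poisson sqrrN. Qed.

Lemma continuous_poisson e : 0 < e -> continuous (poisson e).
Proof.
move=> e0 x; apply: cvgM; first exact: cvg_cst.
apply: cvgV; first by rewrite gt_eqF// ltr_pwDl ?sqr_ge0// exprn_gt0.
by apply: cvgD; [exact: cvg_cst|exact: exprn_continuous].
Qed.

Lemma ge0_integral_poisson (e : R) : 0 < e -> (\int[mu]_t (poisson e t)%:E = (2 * pi)%:E)%E.
Proof.
move=> e0.
rewrite ge0_symfun_integralT//; [|by move=> x; exact: poisson_ge0|exact: continuous_poisson|
  by move=> x /=; rewrite poissonN].
rewrite -set_itvcy.
have dF x : is_derive (x : R) (1 : R) (fun x : R => 2 * atan (x / e)) (poisson e x).
  apply: is_derive_eq; rewrite /poisson /GRing.scale/=; field.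
  by rewrite !gt_eqF// ltr_pwDl ?sqr_ge0// exprn_gt0.
rewrite (@ge0_continuous_FTC2y _ _ (fun x => 2 * atan (x / e)) _ pi)//=.
- by rewrite mul0r atan0 mulr0 sube0.
- by move=> x _; exact: poisson_ge0.
- exact/continuous_subspaceT/continuous_poisson.
- rewrite [X in _ --> X](_ : pi = 2 * (pi / 2) :> R); last by field.
  apply: cvgM; first exact: cvg_cst.
  apply: (cvg_comp _ _ _ (@cvgy_atan R)).
  apply/cvgryPge => A; exists (A * e); split; first exact: num_real.
  by move=> x Ax; rewrite ler_pdivlMr// ltW.
- exact/cvg_at_right_filter/(is_derive_cvg _ _ _ (dF 0)).
- by move=> x _; rewrite derive1E; exact: derive_val.
Qed.

Lemma ge0_integral_poisson_shift (e s : R) : 0 < e ->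
  (\int[mu]_t (poisson e (s - t))%:E = (2 * pi)%:E)%E.
Proof.
move=> e0; rewrite -(ge0_integral_poisson _ e0).
have mpoisson : measurable_fun [set: R] (EFin \o poisson e).
  by apply/measurable_EFinP; exact: (continuous_measurable_fun (continuous_poisson _ e0)).
rewrite -[RHS](@ge0_integral_shift (EFin \o poisson e) (- s))//=; last first.
  by move=> r; rewrite lee_fin poisson_ge0.
by apply: eq_integral => t _; rewrite -poissonN opprB.
Qed.

Lemma emeasurable_poisson2 e : 0 < e ->
  measurable_fun setT (fun z : R * R => (poisson e (z.1 - z.2))%:E).
Proof.
move=> e0; apply/measurable_EFinP.
apply: (measurableT_comp (continuous_measurable_fun (continuous_poisson _ e0))).
by apply: measurable_funB; [exact: measurable_fst|exact: measurable_snd].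
Qed.

Lemma ge0_integral_sum_poisson e (b : R -> \bar R) : 0 < e -> measurable_fun [set: R] b ->
  (forall t, 0 <= b t)%E ->
  (\int[mu]_s \int[mu]_t ((b s + b t) * (poisson e (s - t))%:E) =
   (4 * pi)%:E * \int[mu]_t b t)%E.
Proof.
move=> e0 mb b0.
have mpoisson (s : R) : measurable_fun [set: R] (fun t => (poisson e (s - t))%:E).
  have /measurable_EFinP := emeasurable_poisson2 _ e0 => m.
  apply/measurable_EFinP; have := measurable_funB (measurable_cst s) (@measurable_id _ R setT).
  exact: (measurableT_comp (continuous_measurable_fun (continuous_poisson _ e0))).
have poi0 s t : (0 <= (poisson e (s - t))%:E)%E by rewrite lee_fin poisson_ge0.
have E1 s : (\int[mu]_t (b s * (poisson e (s - t))%:E) = b s * (2 * pi)%:E)%E.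
  rewrite ge0_integralZl ?(ge0_integral_poisson_shift _ s e0)//; exact: mpoisson.
have mF : measurable_fun setT (fun z : R * R => b z.2 * (poisson e (z.1 - z.2))%:E)%E.
  apply: emeasurable_funM; last exact: emeasurable_poisson2.
  by apply: (measurableT_comp mb); exact: measurable_snd.
have F0 (z : R * R) : (0 <= b z.2 * (poisson e (z.1 - z.2))%:E)%E by rewrite mule_ge0.
transitivity (\int[mu]_s (b s * (2 * pi)%:E) +
   \int[mu]_s \int[mu]_t (b t * (poisson e (s - t))%:E))%E.
  rewrite -ge0_integralD//=; last 4 first.
  - by move=> s _; rewrite mule_ge0// lee_fin mulr_ge0 ?pi_ge0.
  - exact: emeasurable_funM.
  - by move=> s _; apply: integral_ge0 => t _; rewrite mule_ge0.
  - exact: (measurable_fun_fubini_tonelli_F (m2 := mu) _ mF F0).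
  apply: eq_integral => s _; rewrite -E1 -ge0_integralD//=; last 4 first.
  - by move=> t _; rewrite mule_ge0.
  - by apply: emeasurable_funM; [exact: measurable_cst|exact: mpoisson].
  - by move=> t _; rewrite mule_ge0.
  - by apply: emeasurable_funM; [exact: mb|exact: mpoisson].
  by apply: eq_integral => t _; rewrite ge0_muleDl.
have := fubini_tonelli (m1 := mu) (m2 := mu) _ mF F0 => /= ->.
rewrite [X in (_ + X)%E](_ : _ = \int[mu]_s (b s * (2 * pi)%:E))%E; last first.
  apply: eq_integral => t _; rewrite -E1.
  by apply: eq_integral => s _; rewrite -[in RHS]poissonN opprB.
rewrite ge0_integralZr//; last by rewrite lee_fin mulr_ge0 ?pi_ge0.
rewrite -ge0_muleDr; last 2 first.
- by rewrite lee_fin mulr_ge0 ?pi_ge0.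
- by rewrite lee_fin mulr_ge0 ?pi_ge0.
by rewrite muleC -EFinD; congr (EFin _ * _)%E; ring.
Qed.

Definition abel (e w : R) : R := expR (- (e * `|w|)).

Lemma abel_ge0 e w : 0 <= abel e w. Proof. exact: expR_ge0. Qed.

Lemma abel_le1 e w : 0 < e -> abel e w <= 1.
Proof. by move=> e0; rewrite -expR0 ler_expR oppr_le0 mulr_ge0// ltW. Qed.

Lemma continuous_abel e : continuous (abel e).
Proof.
move=> x; apply: continuous_comp; last exact: continuous_expR.
apply: cvgN; apply: cvgM; first exact: cvg_cst.
exact: norm_continuous.
Qed.

Lemma abel_cvg0 e : 0 < e -> expR (- (e * x)) @[x --> +oo] --> (0 : R).
Proof.
move=> e0.
apply: (cvg_comp (fun x => e * x) (fun x => expR (- x))); last exact: cvgr_expR.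
apply/cvgryPge => A; exists (A / e); split; first exact: num_real.
by move=> x Ax; rewrite mulrC -ler_pdivrMr// ltW.
Qed.

(** Adding 1 to the cosine makes the integrand nonnegative, so the fundamental theorem of calculus
    on a half-line applies without prior integrability; [integral_abel_cos] removes the 1 again. *)
Lemma ge0_integral_abel_cos e u : 0 < e ->
  (\int[mu]_w (abel e w * (1 + cos (u * w)))%:E = (2 / e + poisson e u)%:E)%E.
Proof.
move=> e0.
have cf : continuous (fun w => abel e w * (1 + cos (u * w))).
  move=> x; apply: cvgM; first exact: continuous_abel.
  apply: cvgD; first exact: cvg_cst.
  apply: continuous_comp; last exact: continuous_cos.
  by apply: cvgM; [exact: cvg_cst|exact: cvg_id].
have c0 w : 0 <= 1 + cos (u * w) by have := cos_geN1 (u * w); lra.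
rewrite ge0_symfun_integralT//; last 2 first.
- by move=> w; rewrite mulr_ge0 ?abel_ge0.
- by move=> x /=; rewrite /abel normrN mulrN cosN.
rewrite -set_itvcy.
have eu : e ^+ 2 + u ^+ 2 != 0 by rewrite gt_eqF// ltr_pwDl ?sqr_ge0// exprn_gt0.
have eN0 : e != 0 by rewrite gt_eqF.
pose G w : R := - e^-1 + (u * sin (u * w) - e * cos (u * w)) / (e ^+ 2 + u ^+ 2).
pose F (w : R) : R := expR (- (e * w)) * G w.
have dF x : is_derive (x : R) (1 : R) F (expR (- (e * x)) * (1 + cos (u * x))).
  rewrite /F /G; apply: is_derive_eq; rewrite /GRing.scale/=.
  set E := expR _; set C := cos _; set S := sin _.
  by field; rewrite eu eN0.
rewrite (@ge0_continuous_FTC2y _ _ F _ 0)//=.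
- rewrite /F /G !mulr0 oppr0 expR0 sin0 cos0 -EFinD -EFinM; congr EFin.
  by rewrite /poisson; field; rewrite eu eN0.
- by move=> x _; rewrite mulr_ge0 ?abel_ge0.
- exact/continuous_subspaceT.
- have := abel_cvg0 _ e0 => g0.
  pose M := e^-1 + (`|u| + e) / (e ^+ 2 + u ^+ 2).
  have GM w : `|G w| <= M.
    rewrite /G /M (le_trans (ler_normD _ _))// normrN gtr0_norm ?invr_gt0// lerD2l.
    rewrite normrM normfV [`|_ ^+ 2 + _|]ger0_norm ?addr_ge0 ?sqr_ge0//.
    rewrite ler_wpM2r ?invr_ge0 ?addr_ge0 ?sqr_ge0//.
    rewrite (le_trans (ler_normB _ _))// !normrM (gtr0_norm e0) lerD//.
      by rewrite ler_piMr// ler_norml sin_geN1 sin_le1.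
    by rewrite (ler_piMr (ltW e0))// ler_norml cos_geN1 cos_le1.
  apply/cvgr0Pnorm_le => /= d d0.
  have M0 : 0 < M + 1.
    by rewrite ltr_wpDl// (le_trans _ (GM 0)).
  have /cvgr0Pnorm_le := g0 => /(_ (d / (M + 1))).
  rewrite divr_gt0// => /(_ isT); apply: filterS => x xd.
  rewrite /F normrM (le_trans (ler_pM _ _ xd (GM x)))//.
  rewrite -mulrA ler_piMr ?(ltW d0)// mulrC ler_pdivrMr// mul1r; lra.
- exact/cvg_at_right_filter/(is_derive_cvg _ _ _ (dF 0)).
- move=> x; rewrite in_itv/= andbT => x0; rewrite derive1E derive_val /abel.
  by rewrite gtr0_norm.
Qed.

Lemma L1_abel e : 0 < e -> L1 (abel e).
Proof.
move=> e0; have mg := continuous_measurable_fun (@continuous_abel e).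
apply/integrableP; split; first exact/measurable_EFinP.
have := ge0_integral_abel_cos _ 0 e0.
under eq_integral do rewrite mul0r cos0.
move=> E; apply: (@le_lt_trans _ _ (2 / e + poisson e 0)%:E); last by rewrite ltry.
rewrite -E; apply: ge0_le_integral => //=.
- by apply/measurable_EFinP; exact: measurableT_comp.
- by apply/measurable_EFinP; exact: measurable_funM.
- by move=> w _; rewrite lee_fin ger0_norm ?abel_ge0// ler_peMr ?abel_ge0// lerDl.
Qed.

Lemma integral_abel_cos e u : 0 < e ->
  \int[mu]_w (abel e w * cos (u * w)) = poisson e u.
Proof.
move=> e0.
have mcos (v : R) : measurable_fun setT (fun w : R => cos (v * w)).
  by apply: continuous_measurable_fun => x; apply: continuous_comp;
   [exact: mulrl_continuous|exact: continuous_cos].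
have I v : L1 (fun w => abel e w * cos (v * w)).
  apply: (@L1Mb _ _ _ 1) => //; first exact: L1_abel.
  by move=> w; rewrite ler_norml cos_geN1 cos_le1.
have E v : \int[mu]_w abel e w + \int[mu]_w (abel e w * cos (v * w)) = 2 / e + poisson e v.
  rewrite -integralD'//; last exact: L1_abel.
  rewrite /Rintegral -[RHS]/(fine (_)%:E) -ge0_integral_abel_cos//; congr fine.
  by apply: eq_integral => w _; rewrite mulrDr mulr1.
(* The case u = 0 yields the mass 2 / e of [abel e], to be subtracted from [E u]. *)
have := E 0; under [X in _ + X = _]eq_Rintegral do rewrite mul0r cos0 mulr1.
have -> : poisson e 0 = 2 / e.
  by rewrite /poisson expr0n addr0 expr2; field; rewrite gt_eqF.
by have := E u; lra.
Qed.

End Poisson.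

(** * Fourier transforms and Bessel's inequality *)

Section Transform.
Context {R : realType}.
Notation mu := (@lebesgue_measure R).
Implicit Types (a b p q : R -> R) (e s t w M : R).

Lemma normr_cos_le1 (x : R) : `|cos x| <= 1.
Proof. by rewrite ler_norml cos_geN1 cos_le1. Qed.

Lemma normr_sin_le1 (x : R) : `|sin x| <= 1.
Proof. by rewrite ler_norml sin_geN1 sin_le1. Qed.

Lemma measurable_cosM w : measurable_fun [set: R] (fun t : R => cos (t * w)).
Proof.
apply: continuous_measurable_fun => x; apply: continuous_comp;
 [exact: mulrr_continuous|exact: continuous_cos].
Qed.

Lemma measurable_sinM w : measurable_fun [set: R] (fun t : R => sin (t * w)).
Proof.
apply: continuous_measurable_fun => x; apply: continuous_comp;
 [exact: mulrr_continuous|exact: continuous_sin].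
Qed.

(** Two integrable weights and a bounded kernel give an integrable function on the plane. The first
    conclusion also provides the measurability of parametrised integrals. *)
Lemma fubini_bounded p q (k : R * R -> R) M : L1 p -> L1 q ->
    measurable_fun setT k -> (forall z, `|k z| <= M) ->
  L1 (fun x => p x * \int[mu]_y (q y * k (x, y))) /\
  \int[mu]_x (p x * \int[mu]_y (q y * k (x, y))) =
  \int[mu]_y (q y * \int[mu]_x (p x * k (x, y))).
Proof.
move=> ip iq mk kM.
pose F (z : R * R) : \bar R := (p z.1 * q z.2 * k z)%:E.
have mp := L1_measurable _ ip; have mq := L1_measurable _ iq.
have mkx x : measurable_fun setT (fun y : R => k (x, y)).
  exact: (measurableT_comp mk (measurable_pair1 x)).
have mky y : measurable_fun setT (fun x : R => k (x, y)).
  exact: (measurableT_comp mk (measurable_pair2 y)).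
have mF : measurable_fun setT F.
  apply/measurable_EFinP; apply: measurable_funM => //; apply: measurable_funM.
    exact: (measurableT_comp mp measurable_fst).
  exact: (measurableT_comp mq measurable_snd).
have iqk x : L1 (fun y => q y * k (x, y)).
  by apply: (@L1Mb _ _ _ M) => // y; exact: kM.
have ipk y : L1 (fun x => p x * k (x, y)).
  by apply: (@L1Mb _ _ _ M) => // x; exact: kM.
have iF : (mu \x mu)%E.-integrable setT F.
  apply/integrable12ltyP => //=.
  pose Q := \int[mu]_y `|q y|.
  have QE : (\int[mu]_y `|q y|%:E = Q%:E)%E by rewrite -EFin_integral//; exact: L1_norm.
  have M0 : 0 <= M by rewrite (le_trans _ (kM (0, 0))).
  apply: (@le_lt_trans _ _ (\int[mu]_x ((M * Q) * `|p x|)%:E)%E); last first.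
    rewrite -EFin_integral ?ltry//; apply: L1Z; exact: L1_norm.
  have Q0 : 0 <= Q by apply: Rintegral_ge0.
  apply: ge0_le_integral => //=.
  - by move=> x _; apply: integral_ge0.
  - exact: (measurable_fun_fubini_tonelli_F (m2 := mu) (fun z => `|F z|)%E (measurableT_comp _ mF)).
  - apply/measurable_EFinP; apply: measurable_funM => //; exact: measurableT_comp.
  - move=> x _.
    apply: (@le_trans _ _ (\int[mu]_y ((M * `|p x|) * `|q y|)%:E)%E).
      apply: ge0_le_integral => //=.
      + apply/measurable_EFinP; apply: measurableT_comp => //.
        apply: measurable_funM; last exact: mkx.
        by apply: measurable_funM; [exact: measurable_cst|exact: mq].
      + by apply/measurable_EFinP; apply: measurable_funM => //; exact: measurableT_comp.
      + move=> y _; rewrite lee_fin !normrM mulrC mulrA ler_wpM2r//.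
        by rewrite ler_wpM2r.
    under eq_integral do rewrite EFinM.
    rewrite ge0_integralZl//=; last 2 first.
      by apply/measurable_EFinP; exact: measurableT_comp.
      by rewrite lee_fin mulr_ge0.
    by rewrite QE -EFinM lee_fin mulrAC.
have E1 x : (\int[mu]_y F (x, y) = (p x * \int[mu]_y (q y * k (x, y)))%:E)%E.
  rewrite /F /= EFinM EFin_integral// -integralZl//; last exact: iqk.
  by apply: eq_integral => y _; rewrite -EFinM mulrA.
have E2 y : (\int[mu]_x F (x, y) = (q y * \int[mu]_x (p x * k (x, y)))%:E)%E.
  rewrite /F /= EFinM EFin_integral// -integralZl//; last exact: ipk.
  by apply: eq_integral => x _; rewrite -EFinM mulrA (mulrC (q y)).
split.
  have := integrable_fubini_F iF; rewrite /L1; apply: eq_integrable => // x _.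
  exact: E1.
have E := Fubini iF.
rewrite /Rintegral; congr fine.
under eq_integral do rewrite -E1.
by under [RHS]eq_integral do rewrite -E2.
Qed.

(** For real [a], cosT a - i sinT a is the Fourier transform without its factor 1 / sqrt (2 pi). *)
Definition cosT a w : R := \int[mu]_t (a t * cos (t * w)).
Definition sinT a w : R := \int[mu]_t (a t * sin (t * w)).

Lemma L1_cos a w : L1 a -> L1 (fun t => a t * cos (t * w)).
Proof.
move=> ia; apply: (@L1Mb _ _ _ 1) => //; first exact: measurable_cosM.
by move=> x; exact: normr_cos_le1.
Qed.

Lemma L1_sin a w : L1 a -> L1 (fun t => a t * sin (t * w)).
Proof.
move=> ia; apply: (@L1Mb _ _ _ 1) => //; first exact: measurable_sinM.
by move=> x; exact: normr_sin_le1.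
Qed.

Lemma cosT_bounded a w : L1 a -> `|cosT a w| <= \int[mu]_t `|a t|.
Proof.
move=> ia; rewrite (le_trans (le_normr_Rintegral _ (L1_cos _ w ia)))//.
apply: integral_le'; [exact/L1_norm/L1_cos|exact: L1_norm|] => t.
by rewrite normrM ler_piMr// normr_cos_le1.
Qed.

Lemma sinT_bounded a w : L1 a -> `|sinT a w| <= \int[mu]_t `|a t|.
Proof.
move=> ia; rewrite (le_trans (le_normr_Rintegral _ (L1_sin _ w ia)))//.
apply: integral_le'; [exact/L1_norm/L1_sin|exact: L1_norm|] => t.
by rewrite normrM ler_piMr// normr_sin_le1.
Qed.

Lemma measurable_cos2 : measurable_fun setT (fun z : R * R => cos (z.2 * z.1)).
Proof.
apply: (measurableT_comp (continuous_measurable_fun (@continuous_cos R))).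
by apply: measurable_funM; [exact: measurable_snd|exact: measurable_fst].
Qed.

Lemma measurable_sin2 : measurable_fun setT (fun z : R * R => sin (z.2 * z.1)).
Proof.
apply: (measurableT_comp (continuous_measurable_fun (@continuous_sin R))).
by apply: measurable_funM; [exact: measurable_snd|exact: measurable_fst].
Qed.

(* Fubini yields measurability of a parametrised integral only against an
   integrable weight; [abel 1] is a positive continuous one. *)
Lemma measurable_abelK (h : R -> R) : L1 (fun w => abel 1 w * h w) ->
  measurable_fun setT h.
Proof.
move=> /L1_measurable mh.
rewrite (_ : h = fun w => (abel 1 w)^-1 * (abel 1 w * h w)); last first.
  by apply/funext => w; rewrite mulKf// gt_eqF// expR_gt0.
apply: measurable_funM => //; apply: continuous_measurable_fun => x.
by apply: cvgV; [rewrite gt_eqF// expR_gt0|exact: continuous_abel].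
Qed.

Lemma measurable_cosT a : L1 a -> measurable_fun setT (cosT a).
Proof.
move=> ia; apply: measurable_abelK.
by have [] := fubini_bounded _ _ (fun z => cos (z.2 * z.1)) 1
  (L1_abel 1 ltr01) ia measurable_cos2 (fun=> normr_cos_le1 _).
Qed.

Lemma measurable_sinT a : L1 a -> measurable_fun setT (sinT a).
Proof.
move=> ia; apply: measurable_abelK.
by have [] := fubini_bounded _ _ (fun z => sin (z.2 * z.1)) 1
  (L1_abel 1 ltr01) ia measurable_sin2 (fun=> normr_sin_le1 _).
Qed.

Lemma poisson_bounded e u : 0 < e -> `|poisson e u| <= 2 / e.
Proof.
move=> e0; rewrite ger0_norm ?poisson_ge0// /poisson.
rewrite ler_pdivrMr ?ltr_pwDl ?sqr_ge0 ?exprn_gt0//.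
rewrite (_ : 2 / e * _ = 2 * e + 2 / e * u ^+ 2); last by field; rewrite gt_eqF.
by rewrite lerDl mulr_ge0 ?sqr_ge0// divr_ge0// ltW.
Qed.

Lemma measurable_poisson2 e : 0 < e ->
  measurable_fun setT (fun z : R * R => poisson e (z.1 - z.2)).
Proof. by move=> e0; apply/measurable_EFinP; exact: emeasurable_poisson2. Qed.

Lemma measurable_poisson1 e s : 0 < e ->
  measurable_fun setT (fun t : R => poisson e (s - t)).
Proof. by move=> e0; exact: (measurableT_comp (measurable_poisson2 _ e0) (measurable_pair1 s)). Qed.

Lemma L1_poisson e s : 0 < e -> L1 (fun t => poisson e (s - t)).
Proof.
move=> e0; apply/integrableP; split.
  by apply/measurable_EFinP; exact: measurable_poisson1.
under eq_integral do rewrite /= ger0_norm ?poisson_ge0//.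
by rewrite ge0_integral_poisson_shift// ltry.
Qed.

Definition poisson_form e a : R := \int[mu]_s (a s * \int[mu]_t (a t * poisson e (s - t))).

Lemma L1_poisson_form e a : 0 < e -> L1 a ->
  L1 (fun s => a s * \int[mu]_t (a t * poisson e (s - t))).
Proof.
move=> e0 ia.
by have [] := fubini_bounded _ _ (fun z => poisson e (z.1 - z.2)) (2 / e)
  ia ia (measurable_poisson2 _ e0) (fun=> poisson_bounded _ _ e0).
Qed.

(** The energy density at w is the double integral of a(s) a(t) cos ((s - t) w), and integrating the
    cosine against [abel e] gives the Poisson kernel. The integrals over s and t are pulled out one
    at a time, so that each exchange has a bounded kernel: first [k], which still contains the
    transforms, then [h]. *)
Lemma integral_abel_fourier e a : 0 < e -> L1 a ->
  \int[mu]_w (abel e w * (cosT a w ^+ 2 + sinT a w ^+ 2)) = poisson_form e a.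
Proof.
move=> e0 ia; pose B := \int[mu]_t `|a t|.
pose k (z : R * R) := cosT a z.1 * cos (z.2 * z.1) + sinT a z.1 * sin (z.2 * z.1).
have mk : measurable_fun setT k.
  apply: measurable_funD; apply: measurable_funM.
  - exact: (measurableT_comp (measurable_cosT _ ia) measurable_fst).
  - exact: measurable_cos2.
  - exact: (measurableT_comp (measurable_sinT _ ia) measurable_fst).
  - exact: measurable_sin2.
have kB z : `|k z| <= B + B.
  rewrite (le_trans (ler_normD _ _))// !normrM lerD//.
    by rewrite (le_trans _ (cosT_bounded _ z.1 ia))// ler_piMr// normr_cos_le1.
  by rewrite (le_trans _ (sinT_bounded _ z.1 ia))// ler_piMr// normr_sin_le1.
have [_ E] := fubini_bounded _ _ _ _ (L1_abel _ e0) ia mk kB.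
transitivity (\int[mu]_w (abel e w * \int[mu]_s (a s * k (w, s)))).
  congr Rintegral; apply/funext => w; congr (_ * _).
  under [RHS]eq_Rintegral do rewrite /k /= mulrDr mulrCA (mulrCA _ (sinT a w)).
  rewrite integralD'; [|exact/L1Z/L1_cos|exact/L1Z/L1_sin].
  by rewrite (integralZ' _ _ (L1_cos _ w ia)) (integralZ' _ _ (L1_sin _ w ia)) !expr2.
rewrite E; congr Rintegral; apply/funext => s; congr (_ * _).
pose h (z : R * R) := cos ((s - z.2) * z.1).
have mh : measurable_fun setT h.
  apply: (measurableT_comp (continuous_measurable_fun (@continuous_cos R))).
  apply: measurable_funM; last exact: measurable_fst.
  by apply: measurable_funB => //; exact: measurable_snd.
have [_ E'] := fubini_bounded _ _ h 1 (L1_abel _ e0) ia mh (fun=> normr_cos_le1 _).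
transitivity (\int[mu]_w (abel e w * \int[mu]_t (a t * h (w, t)))).
  congr Rintegral; apply/funext => w; congr (_ * _).
  rewrite /k /h /=.
  under [RHS]eq_Rintegral => t _.
    rewrite mulrBl cosB mulrDr mulrCA (mulrCA (a t)).
    over.
  rewrite integralD'; [|exact/L1Z/L1_cos|exact/L1Z/L1_sin].
  rewrite (integralZ' _ _ (L1_cos _ w ia)) (integralZ' _ _ (L1_sin _ w ia)).
  by rewrite /cosT /sinT mulrC (mulrC (\int[mu]_t (a t * sin (t * w)))).
rewrite E'; congr Rintegral; apply/funext => t; congr (_ * _).
exact: (integral_abel_cos _ (s - t) e0).
Qed.

Lemma L1_sum_poisson e b s : 0 < e -> L1 b ->
  L1 (fun t => (b s + b t) * poisson e (s - t)).
Proof.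
move=> e0 ib.
under eq_fun do rewrite mulrDl; apply: L1D; first exact/L1Z/L1_poisson.
by apply: (@L1Mb _ _ _ (2 / e)) => //; [exact: measurable_poisson1|move=> t; exact: poisson_bounded].
Qed.

(** The identity in extended reals comes first: its finite right-hand side is what proves the outer
    integrand integrable. *)
Lemma integral_sum_poisson e b : 0 < e -> L1 b -> (forall t, 0 <= b t) ->
  L1 (fun s => \int[mu]_t ((b s + b t) * poisson e (s - t))) /\
  \int[mu]_s \int[mu]_t ((b s + b t) * poisson e (s - t)) = 4 * pi * \int[mu]_t b t.
Proof.
move=> e0 ib b0.
have mb := L1_measurable _ ib.
have := ge0_integral_sum_poisson _ (EFin \o b) e0 (proj2 (measurable_EFinP _ _) mb) (fun t => b0 t).
have U s : (\int[mu]_t ((((b s)%:E + (b t)%:E) * (poisson e (s - t))%:E)) =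
   (\int[mu]_t ((b s + b t) * poisson e (s - t)))%:E)%E.
  by rewrite EFin_integral//; exact: L1_sum_poisson.
have U0 s : 0 <= \int[mu]_t ((b s + b t) * poisson e (s - t)).
  by apply: Rintegral_ge0 => t _; rewrite mulr_ge0 ?addr_ge0 ?poisson_ge0.
under eq_integral do rewrite /= U.
have -> : (\int[mu]_t (EFin \o b) t = (\int[mu]_t b t)%:E)%E by rewrite EFin_integral.
rewrite -EFinM => T.
split; last by rewrite /Rintegral T.
apply/integrableP; split; last first.
  under eq_integral do rewrite /= ger0_norm//.
  by rewrite T ltry.
rewrite (_ : EFin \o _ = fun s => \int[mu]_t ((((b s)%:E + (b t)%:E) * (poisson e (s - t))%:E)))%E; last first.
  by apply/funext => s; rewrite U.
apply: (measurable_fun_fubini_tonelli_F (m2 := mu) (fun z : R * R => ((b z.1 + b z.2) * poisson e (z.1 - z.2))%:E)).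
  apply/measurable_EFinP; apply: measurable_funM; last exact: measurable_poisson2.
  apply: measurable_funD; first exact: (measurableT_comp mb measurable_fst).
  exact: (measurableT_comp mb measurable_snd).
by move=> z; rewrite lee_fin mulr_ge0 ?addr_ge0 ?poisson_ge0.
Qed.

Lemma integral_sqr_diff_poisson e a : 0 < e -> L1 a -> L2 a ->
  L1 (fun s => \int[mu]_t ((a s - a t) ^+ 2 * poisson e (s - t))) /\
  \int[mu]_s \int[mu]_t ((a s - a t) ^+ 2 * poisson e (s - t)) =
  4 * pi * \int[mu]_t (a t ^+ 2) - 2 * poisson_form e a.
Proof.
move=> e0 ia [ma ia2].
have [iU EU] := integral_sum_poisson _ (fun t => a t ^+ 2) e0 ia2 (fun t => sqr_ge0 (a t)).
have iJ := L1_poisson_form _ _ e0 ia.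
have E : (fun s => \int[mu]_t ((a s - a t) ^+ 2 * poisson e (s - t))) =
  (fun s => \int[mu]_t ((a s ^+ 2 + a t ^+ 2) * poisson e (s - t)) -
   2 * (a s * \int[mu]_t (a t * poisson e (s - t)))).
  apply/funext => s; rewrite -!integralZ'; last 2 first.
  - apply: L1Z; apply: (@L1Mb _ _ _ (2 / e)) => //; [exact: measurable_poisson1|].
    by move=> t; exact: poisson_bounded.
  - apply: (@L1Mb _ _ _ (2 / e)) => //; [exact: measurable_poisson1|].
    by move=> t; exact: poisson_bounded.
  rewrite -integralB'; last 2 first.
  - exact: (L1_sum_poisson _ (fun t => a t ^+ 2)).
  - apply: L1Z; apply: L1Z; apply: (@L1Mb _ _ _ (2 / e)) => //; [exact: measurable_poisson1|].
    by move=> t; exact: poisson_bounded.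
  by apply: eq_Rintegral => t _; ring.
rewrite E; split; first by apply: L1B => //; exact: L1Z.
by rewrite integralB' ?integralZ' ?EU//; exact: L1Z.
Qed.

Lemma poisson_form_le e a : 0 < e -> L1 a -> L2 a -> poisson_form e a <= 2 * pi * \int[mu]_t (a t ^+ 2).
Proof.
move=> e0 ia ia2; have [_] := integral_sqr_diff_poisson _ _ e0 ia ia2.
have : 0 <= \int[mu]_s \int[mu]_t ((a s - a t) ^+ 2 * poisson e (s - t)).
  apply: Rintegral_ge0 => s _; apply: Rintegral_ge0 => t _.
  by rewrite mulr_ge0 ?sqr_ge0 ?poisson_ge0.
lra.
Qed.

(** Along e = 1 / (n + 1) the Abel weights increase to 1, so monotone convergence carries the bound
    of [poisson_form_le] to the unweighted energy. Finiteness of that limit is also what puts both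
    transforms in L^2. *)
Lemma bessel a : L1 a -> L2 a ->
  [/\ L2 (cosT a), L2 (sinT a) & 
  \int[mu]_w (cosT a w ^+ 2 + sinT a w ^+ 2) <= 2 * pi * \int[mu]_t (a t ^+ 2)].
Proof.
move=> ia ia2; set B := 2 * pi * _.
have mC := measurable_cosT _ ia; have mS := measurable_sinT _ ia.
pose h w := cosT a w ^+ 2 + sinT a w ^+ 2.
have mh : measurable_fun setT h.
  by apply: measurable_funD; exact: measurable_funX.
have h0 w : 0 <= h w by rewrite addr_ge0 ?sqr_ge0.
pose en n : R := n.+1%:R^-1.
have en0 n : 0 < en n by rewrite invr_gt0.
have ih n : L1 (fun w => abel (en n) w * h w).
  apply: (@L1Mb _ _ _ ((\int[mu]_t `|a t|) ^+ 2 + (\int[mu]_t `|a t|) ^+ 2)) => //.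
    exact: L1_abel.
  move=> w; rewrite ger0_norm// lerD//.
    rewrite -(real_normK (num_real (cosT a w))) lerXn2r ?nnegrE//.
      by apply: Rintegral_ge0.
    exact: cosT_bounded.
  rewrite -(real_normK (num_real (sinT a w))) lerXn2r ?nnegrE//.
    by apply: Rintegral_ge0.
  exact: sinT_bounded.
have lim : (\int[mu]_w (abel (en n) w * h w)%:E)%E @[n --> \oo] --> (\int[mu]_w (h w)%:E)%E.
  rewrite [X in _ --> X](_ : _ = \int[mu]_w limn (fun n => (abel (en n) w * h w)%:E))%E.
    apply: cvg_monotone_convergence => //.
    - by move=> n; apply/measurable_EFinP; exact: L1_measurable.
    - by move=> n w _; rewrite lee_fin mulr_ge0 ?abel_ge0.
    - move=> w _ n m nm; rewrite lee_fin ler_wpM2r// /abel ler_expR lerN2.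
      by rewrite ler_wpM2r// lef_pV2 ?posrE// ler_nat.
  apply: eq_integral => w _; apply/esym/cvg_lim => //.
  apply: cvg_EFin; first exact: nearW.
  rewrite -[X in _ --> X]mul1r; apply: cvgM; last exact: cvg_cst.
  rewrite -expR0 -oppr0 -(mul0r `|w|).
  apply: continuous_cvg; first exact: continuous_expR.
  apply: cvgN; apply: cvgM; last exact: cvg_cst.
  exact: cvg_harmonic.
have hB : (\int[mu]_w (h w)%:E <= B%:E)%E.
  rewrite -(cvg_lim _ lim)//; apply: lime_le.
    by apply/cvg_ex; eexists; exact: lim.
  apply: nearW => n; rewrite -EFin_integral// lee_fin integral_abel_fourier//.
  exact: poisson_form_le.
have iL : L1 h.
  apply/integrableP; split; first exact/measurable_EFinP.
  under eq_integral do rewrite /= ger0_norm//.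
  by rewrite (le_lt_trans hB)// ltry.
split.
- split => //; apply: (L1_le _ _ _ iL); first exact: measurable_funX.
  by move=> w; rewrite ger0_norm ?sqr_ge0// lerDl sqr_ge0.
- split => //; apply: (L1_le _ _ _ iL); first exact: measurable_funX.
  by move=> w; rewrite ger0_norm ?sqr_ge0// lerDr sqr_ge0.
- by rewrite -lee_fin EFin_integral.
Qed.

End Transform.

(** * Plancherel identity *)

Section Plancherel.
Context {R : realType}.
Notation mu := (@lebesgue_measure R).
Implicit Types (a b p q : R -> R) (e s t w M : R).

Lemma le0_forall_gt0 (x : R) : (forall d : R, 0 < d -> x <= d) -> x <= 0.
Proof. by move=> h; apply/ler_addgt0Pr => d d0; rewrite add0r h. Qed.

Definition fourier_energy a : R := \int[mu]_w (cosT a w ^+ 2 + sinT a w ^+ 2).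
(** Nonnegative by Bessel's inequality; it is shown to vanish successively on Lipschitz, bounded and
    square integrable functions of compact support. *)
Definition plancherel_defect a : R := 2 * pi * \int[mu]_t (a t ^+ 2) - fourier_energy a.

Lemma cosTD a b w : L1 a -> L1 b -> cosT (fun t => a t + b t) w = cosT a w + cosT b w.
Proof.
move=> ia ib; rewrite /cosT -(integralD' _ _ (L1_cos _ w ia) (L1_cos _ w ib)).
by apply: eq_Rintegral => t _; rewrite mulrDl.
Qed.

Lemma sinTD a b w : L1 a -> L1 b -> sinT (fun t => a t + b t) w = sinT a w + sinT b w.
Proof.
move=> ia ib; rewrite /sinT -(integralD' _ _ (L1_sin _ w ia) (L1_sin _ w ib)).
by apply: eq_Rintegral => t _; rewrite mulrDl.
Qed.

Lemma cosTN a w : L1 a -> cosT (fun t => - a t) w = - cosT a w.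
Proof.
move=> ia; rewrite /cosT -mulN1r -(integralZ' _ _ (L1_cos _ w ia)).
by apply: eq_Rintegral => t _; rewrite mulN1r mulNr.
Qed.

Lemma sinTN a w : L1 a -> sinT (fun t => - a t) w = - sinT a w.
Proof.
move=> ia; rewrite /sinT -mulN1r -(integralZ' _ _ (L1_sin _ w ia)).
by apply: eq_Rintegral => t _; rewrite mulN1r mulNr.
Qed.

Lemma L1_fourier_energy a : L1 a -> L2 a -> L1 (fun w => cosT a w ^+ 2 + sinT a w ^+ 2).
Proof.
by move=> ia i2; have [C S _] := bessel _ ia i2; apply: L1D; exact: L2_sqr.
Qed.

Lemma plancherel_defect_ge0 a : L1 a -> L2 a -> 0 <= plancherel_defect a.
Proof. by move=> ia ia2; have [_ _ h] := bessel _ ia ia2; rewrite subr_ge0. Qed.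

Lemma fourier_energy_ge0 a : 0 <= fourier_energy a.
Proof. by apply: Rintegral_ge0 => w _; rewrite addr_ge0 ?sqr_ge0. Qed.

Lemma plancherel_defect_parallelogram a b : L1 a -> L2 a -> L1 b -> L2 b ->
  plancherel_defect (fun t => a t + b t) + plancherel_defect (fun t => a t - b t) = 2 * plancherel_defect a + 2 * plancherel_defect b.
Proof.
move=> a1 a2 b1 b2.
have P : \int[mu]_t ((a t + b t) ^+ 2) + \int[mu]_t ((a t - b t) ^+ 2) =
   2 * \int[mu]_t (a t ^+ 2) + 2 * \int[mu]_t (b t ^+ 2).
  rewrite -(integralZ' _ _ (L2_sqr _ a2)) -(integralZ' _ _ (L2_sqr _ b2)).
  rewrite -(integralD' _ _ (L1Z _ _ (L2_sqr _ a2)) (L1Z _ _ (L2_sqr _ b2))).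
  rewrite -(integralD' _ _ (L2_sqr _ (L2D _ _ a2 b2)) (L2_sqr _ (L2B _ _ a2 b2))).
  by apply: eq_Rintegral => t _; ring.
have T : fourier_energy (fun t => a t + b t) + fourier_energy (fun t => a t - b t) = 2 * fourier_energy a + 2 * fourier_energy b.
  have iT := L1_fourier_energy.
  rewrite /fourier_energy -(integralZ' _ _ (iT _ a1 a2)) -(integralZ' _ _ (iT _ b1 b2)).
  rewrite -(integralD' _ _ (L1Z _ _ (iT _ a1 a2)) (L1Z _ _ (iT _ b1 b2))).
  rewrite -(integralD' _ _ (iT _ (L1D _ _ a1 b1) (L2D _ _ a2 b2))
    (iT _ (L1B _ _ a1 b1) (L2B _ _ a2 b2))).
  apply: eq_Rintegral => w _.
  rewrite (cosTD _ _ _ a1 b1) (sinTD _ _ _ a1 b1) (cosTD _ _ _ a1 (L1N _ b1)).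
  by rewrite (sinTD _ _ _ a1 (L1N _ b1)) cosTN// sinTN//; ring.
rewrite /plancherel_defect addrACA -mulrDr P -opprD T.
move: (fourier_energy a) (fourier_energy b) (\int[mu]_t _) (\int[mu]_t _) (pi : R) => u v r q z; ring.
Qed.

(* The defect is a nonnegative quadratic form bounded by 2 pi |a|^2, so the
   parallelogram law makes its zero set closed in L^2. *)
Lemma plancherel_defect_closed a : L1 a -> L2 a ->
  (forall d : R, 0 < d -> exists p : R -> R, [/\ L1 p, L2 p, plancherel_defect p = 0 &
     \int[mu]_t ((a t - p t) ^+ 2) <= d]) ->
  plancherel_defect a = 0.
Proof.
move=> a1 a2 H; apply/eqP; rewrite eq_le plancherel_defect_ge0// andbT.
apply: le0_forall_gt0 => d d0.
have pi0 := @pi_gt0 R.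
(* With r = a - p, the parallelogram law bounds the defect of a = p + r by twice that of r, which is
   at most 2 * 2 pi * d / (4 pi) = d. *)
have [|p [p1 p2 Qp0 hd]] := H (d / (4 * pi)); first by rewrite divr_gt0// mulr_gt0.
have r1 := L1B _ _ a1 p1; have r2 := L2B _ _ a2 p2.
have := plancherel_defect_parallelogram _ _ p1 p2 r1 r2.
rewrite (_ : (fun t => p t + (a t - p t)) = a); last by apply/funext => t; ring.
have := plancherel_defect_ge0 _ (L1B _ _ p1 r1) (L2B _ _ p2 r2).
have : plancherel_defect (fun t => a t - p t) <= 2 * pi * \int[mu]_t ((a t - p t) ^+ 2).
  by rewrite gerBl fourier_energy_ge0.
have : 2 * pi * \int[mu]_t ((a t - p t) ^+ 2) <= d / 2.
  apply: (@le_trans _ _ (2 * pi * (d / (4 * pi)))).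
    by rewrite ler_wpM2l// mulr_ge0// ltW.
  have piN0 : pi != 0 :> R by rewrite gt_eqF.
  rewrite (_ : 2 * pi * _ = d / 2)//.
  by move: piN0; move: (pi : R) => P P0; field.
rewrite Qp0 mulr0 add0r.
move: (plancherel_defect a) (plancherel_defect _) (plancherel_defect _) (2 * pi * _) => u v r x; lra.
Qed.

(** The Poisson form is the energy damped by weights at most 1, so a lower bound on the form is one
    on the energy. *)
Lemma poisson_form_le_energy e a : 0 < e -> L1 a -> L2 a -> poisson_form e a <= fourier_energy a.
Proof.
move=> e0 a1 a2; rewrite -integral_abel_fourier//; have iT := L1_fourier_energy _ a1 a2.
apply: integral_le' => //.
  have := L1Mb _ _ 1 iT (continuous_measurable_fun (continuous_abel e)).
  under eq_fun do rewrite mulrC; apply => w.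
  by rewrite ger0_norm ?abel_ge0 ?abel_le1.
by move=> w; rewrite ler_piMl ?abel_le1// addr_ge0 ?sqr_ge0.
Qed.

(* (a(s) - a(t))^2 p_e(s - t) <= K e (b(s) + b(t)) p_1(s - t), where b is the
   indicator of the support, so the double integral is O(e). *)
Lemma plancherel_defect_lipschitz a (x y L M : R) : measurable_fun setT a ->
  (forall s t, `|a s - a t| <= L * `|s - t|) -> (forall s, `|a s| <= M) ->
  (forall z, z \notin `[x, y] -> a z = 0) -> plancherel_defect a = 0.
Proof.
move=> ma aL aM a0.
have a2 := bounded_itv_L2 _ _ _ _ ma aM a0; have a1 := L2_itv_L1 _ _ _ a2 a0.
apply/eqP; rewrite eq_le plancherel_defect_ge0// andbT.
pose b : R -> R := \1_(`[x, y]%classic).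
have b0 t : 0 <= b t by rewrite /b indicE.
have ib : L1 b := L1_indic_itv x y.
(* With d = a(s) - a(t) and u = s - t, the Lipschitz bound gives d^2 <= L^2 u^2 and the sup bound
   gives d^2 u^2 <= (2M)^2 u^2. Hence d^2 (1 + u^2) <= K u^2 <= K (e^2 + u^2), which compares the
   two kernels. *)
pose K := L ^+ 2 + (2 * M) ^+ 2.
have K0 : 0 <= K by rewrite addr_ge0 ?sqr_ge0.
have De e : 0 < e -> 4 * pi * \int[mu]_t (a t ^+ 2) - 2 * poisson_form e a <=
    K * e * (4 * pi * \int[mu]_t b t).
  move=> e0; have [iD <-] := integral_sqr_diff_poisson _ _ e0 a1 a2.
  have [iS <-] := integral_sum_poisson _ _ ltr01 ib b0.
  rewrite -integralZ'//; apply: integral_le' => //; first exact: L1Z.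
  move=> s; rewrite -(integralZ' _ _ (L1_sum_poisson _ _ s ltr01 ib)).
  have iL : L1 (fun t => (a s - a t) ^+ 2 * poisson e (s - t)).
    apply: (@L1_le _ _ (fun t => (2 * M) ^+ 2 * poisson e (s - t))).
    - apply: measurable_funM; last exact: measurable_poisson1.
      by apply: measurable_funX; exact: measurable_funB.
    - by apply: L1Z; exact: L1_poisson.
    - move=> t; rewrite normrM [`|poisson _ _|]ger0_norm ?poisson_ge0// ler_wpM2r ?poisson_ge0//.
      rewrite normrX lerXn2r ?nnegrE// ?mulr_ge0// ?(le_trans _ (aM s))//.
      by rewrite (le_trans (ler_normB _ _))// mulr_natl mulr2n lerD.
  apply: integral_le' => //; first exact/L1Z/L1_sum_poisson.
  (* The sum is at least 1 as soon as s or t lies in [x, y]; otherwise a(s) = a(t) = 0. *)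
  move=> t; have [bst|/negP] := boolP (1 <= b s + b t); last first.
    rewrite /b !indicE !mem_setE => h.
    have -> : a s = 0 by apply: a0; apply: contra_notN h => ->; rewrite lerDl.
    have -> : a t = 0 by apply: a0; apply: contra_notN h => ->; rewrite lerDr.
    rewrite subr0 expr0n mul0r; apply: mulr_ge0; first by rewrite mulr_ge0// ltW.
    by rewrite mulr_ge0 ?addr_ge0 ?poisson_ge0.
  apply: (@le_trans _ _ (K * e * (1 * poisson 1 (s - t)))); last first.
    by rewrite ler_wpM2l ?mulr_ge0 ?(ltW e0)// ler_wpM2r// poisson_ge0.
  rewrite /poisson; set u := s - t; set d := a s - a t.
  have eu : 0 < e ^+ 2 + u ^+ 2 by rewrite ltr_pwDl ?sqr_ge0 ?exprn_gt0.
  have u1 : 0 < 1 ^+ 2 + u ^+ 2 by rewrite ltr_pwDl ?sqr_ge0 ?exprn_gt0.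
  have d1 : d ^+ 2 <= L ^+ 2 * u ^+ 2.
    rewrite -exprMn -(real_normK (num_real d)) -[leRHS](real_normK (num_real _)).
    rewrite lerXn2r ?nnegrE// normrM (le_trans (aL s t))// ler_wpM2r//.
    exact: ler_norm.
  have d2 : d ^+ 2 <= (2 * M) ^+ 2.
    rewrite -(real_normK (num_real d)) lerXn2r ?nnegrE//.
      by rewrite mulr_ge0// (le_trans _ (aM s)).
    by rewrite (le_trans (ler_normB _ _))// mulr_natl mulr2n lerD.
  rewrite mulrA ler_pdivrMr// mul1r mulr1 [leRHS](_ : _ = K * (2 * e) * (e ^+ 2 + u ^+ 2) / (1 ^+ 2 + u ^+ 2)); last first.
    by field; rewrite gt_eqF// -[X in _ < X + _](expr1n _ 2).
  rewrite ler_pdivlMr// (_ : d ^+ 2 * _ * _ = (2 * e) * (d ^+ 2 * (1 ^+ 2 + u ^+ 2))); last by ring.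
  rewrite (_ : K * _ * _ = (2 * e) * (K * (e ^+ 2 + u ^+ 2))); last by ring.
  rewrite ler_wpM2l ?mulr_ge0 ?(ltW e0)// expr1n mulrDr mulr1.
  apply: (@le_trans _ _ (K * u ^+ 2)); last first.
    by rewrite ler_wpM2l// lerDr sqr_ge0.
  by rewrite /K mulrDl lerD// ler_wpM2r// sqr_ge0.
apply: le0_forall_gt0 => d d0.
have pi0 := @pi_gt0 R.
(* The right-hand side of [De] is 2 B e; dividing d by B + 1 makes B e <= d and covers the case B =
   0. *)
pose B := K * (2 * pi * \int[mu]_t b t).
have B0 : 0 <= B.
  by rewrite mulr_ge0// !mulr_ge0 ?(ltW pi0)//; apply: Rintegral_ge0 => t _; exact: b0.
have B1 : 0 < B + 1 by rewrite ltr_wpDl.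
have e0 : 0 < d / (B + 1) by rewrite divr_gt0.
have := De _ e0; have := poisson_form_le_energy _ _ e0 a1 a2.
set e := d / (B + 1) => hT.
rewrite (_ : K * e * _ = 2 * (B * e)); last by rewrite /B; ring.
have : B * e <= d.
  by rewrite /e mulrA ler_pdivrMr// mulrC ler_wpM2l ?(ltW d0)// lerDl.
rewrite /plancherel_defect; move: hT.
move: (fourier_energy a) (poisson_form e a) (\int[mu]_t (a t ^+ 2)) (B * e) => u v r q; lra.
Qed.

Lemma L2_approx (p : nat -> R -> R) a b : (forall n, measurable_fun setT (p n)) ->
  measurable_fun setT a -> L1 b -> {ae mu, forall x, p ^~ x @ \oo --> a x} ->
  (forall n x, (a x - p n x) ^+ 2 <= b x) ->
  forall d : R, 0 < d -> exists n, \int[mu]_t ((a t - p n t) ^+ 2) <= d.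
Proof.
move=> mp ma ib pa pb d d0.
have md n : measurable_fun setT (fun x => (a x - p n x) ^+ 2).
  by apply: measurable_funX; exact: measurable_funB.
have [|||||_ _] := @dominated_convergence _ _ R mu setT measurableT
  (fun n x => ((a x - p n x) ^+ 2)%:E) (cst 0%E) (EFin \o b).
- by move=> n; exact: (proj2 (measurable_EFinP _ _) (md n)).
- exact: measurable_cst.
- move: pa; apply: filterS; first exact: (ae_filter_ringOfSetsType mu).
  move=> x px _; apply: cvg_EFin; first exact: nearW.
  rewrite [X in _ --> X](_ : 0 = (a x - a x) ^+ 2); last by rewrite subrr expr0n.
  rewrite (_ : fine \o _ = fun n => (a x - p n x) * (a x - p n x)); last first.
    by apply/funext => n /=; rewrite expr2.
  by rewrite expr2; apply: cvgM; apply: cvgB => //; exact: cvg_cst.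
- exact: ib.
- by apply: aeW => x n _ /=; rewrite lee_fin ger0_norm ?sqr_ge0.
rewrite integral0 => /fine_cvgP[_ /cvgrPdist_le /(_ d d0)[n _ /(_ n (leqnn n))]].
rewrite /= sub0r normrN => h; exists n.
by apply: le_trans h; exact: ler_norm.
Qed.

(* Approximation by difference quotients of the primitive of a, which are
   Lipschitz and converge a.e. by Lebesgue differentiation. *)
Lemma plancherel_defect_bounded a (x y M : R) : measurable_fun setT a ->
  (forall s, `|a s| <= M) ->
  (forall z, z \notin `[x, y] -> a z = 0) -> plancherel_defect a = 0.
Proof.
move=> ma aM a0.
have a2 := bounded_itv_L2 _ _ _ _ ma aM a0; have a1 := L2_itv_L1 _ _ _ a2 a0.
have M0 : 0 <= M by rewrite (le_trans _ (aM 0)).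
pose F z := \int[mu]_(t in `]-oo, z]) a t.
have iA (D : set R) : measurable D -> mu.-integrable D (EFin \o a).
  by move=> mD; apply: integrableS a1.
have FB (z z' : R) : z <= z' -> F z' - F z = \int[mu]_(t in `]z, z']) a t.
  by move=> zz; apply: Rintegral_itvB => //; exact: iA.
have FL (z z' : R) : z <= z' -> `|F z' - F z| <= M * (z' - z).
  move=> zz; rewrite FB// (le_trans (le_normr_Rintegral _ _))//; first exact: iA.
  have -> : M * (z' - z) = \int[mu]_(t in `]z, z']) M.
    rewrite Rintegral_cst//= lebesgue_measure_itv/= lte_fin.
    by move: zz; rewrite le_eqVlt => /predU1P[->|->//]; rewrite ltxx subrr.
  apply: le_Rintegral => //.
    by apply: integrable_norm; exact: iA.
  apply: measurable_bounded_integrable => //.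
    by rewrite /= lebesgue_measure_itv/=; case: ifP => // _; rewrite -EFinD ltry.
  exact: bounded_cst.
pose p n s : R := n.+1%:R * (F (s + n.+1%:R^-1) - F s).
have h0 n : 0 <= n.+1%:R^-1 :> R by rewrite invr_ge0.
have FLn (z z' : R) : `|F z - F z'| <= M * `|z - z'|.
  case: (leP z z') => [zz|/ltW zz].
    by rewrite (distrC (F z)) (distrC z) [`|z' - z|]ger0_norm ?subr_ge0// FL.
  by rewrite [`|z - z'|]ger0_norm ?subr_ge0// FL.
have pM n s : `|p n s| <= M.
  rewrite normrM ger0_norm// mulrC -ler_pdivlMr// (le_trans (FL _ _ _))//.
    by rewrite lerDl.
  by rewrite addrAC subrr add0r.
have pL n s t : `|p n s - p n t| <= (2 * n.+1%:R * M) * `|s - t|.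
  rewrite /p -mulrBr normrM ger0_norm//.
  rewrite (_ : 2 * _ * M * _ = n.+1%:R * (2 * (M * `|s - t|))); last by ring.
  rewrite ler_wpM2l//.
  rewrite (_ : _ - _ = F (s + n.+1%:R^-1) - F (t + n.+1%:R^-1) + (F t - F s)); last by ring.
  rewrite (le_trans (ler_normD _ _))// mulr_natl mulr2n lerD//.
    by rewrite (le_trans (FLn _ _))// opprD addrACA subrr addr0.
  by rewrite (le_trans (FLn _ _))// distrC.
have pc n : continuous (p n).
  move=> s; apply/cvgrPdist_le => d d0.
  pose L := 2 * n.+1%:R * M + 1.
  have L0 : 0 < L by rewrite ltr_wpDl// !mulr_ge0.
  near=> t.
  rewrite (le_trans (pL n s t))// (@le_trans _ _ (L * `|s - t|))//.
    by rewrite ler_wpM2r// lerDl.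
  rewrite mulrC -ler_pdivlMr//.
  by near: t; apply: cvgr_dist_le; [exact: cvg_id|rewrite divr_gt0].
have mp n := continuous_measurable_fun (pc n).
(* The quotients look forward by 1 / (n + 1) <= 1, so the support grows by at most 1, on the
   left. *)
have p0 n z : z \notin `[x - 1, y] -> p n z = 0.
  move=> zxy; rewrite /p FB; last by rewrite lerDl.
  rewrite integral_indic'// (_ : (fun=> _) = cst 0); last first.
    apply/funext => t; rewrite indicE mem_setE/= in_itv/=.
    have [/andP[zt tz]|] := boolP (z < t <= _); last by rewrite mul0r.
    rewrite mul1r a0//; apply: contra zxy; rewrite !in_itv/= => /andP[xt ty].
    rewrite (le_trans (ltW zt))// andbT lerBlDr (le_trans xt)// (le_trans tz)// lerD2l.
    by rewrite invf_le1// ler1n.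
  by rewrite /Rintegral integral0 mulr0.
apply: plancherel_defect_closed => // d d0.
have [|||n hn] := L2_approx p a (fun t => (2 * M) ^+ 2 * \1_(`[x - 1, y]%classic) t) mp ma _ _ _ d d0.
- exact/L1Z/L1_indic_itv.
- have := @FTC1Ny R a.
  have li : locally_integrable setT a.
    by apply: open_integrable_locally; [exact: openT|exact: a1].
  move=> /(_ (fun y => iA _ (measurable_itv _)) li); apply: filterS; first exact: (ae_filter_ringOfSetsType mu).
  move=> z [dF <-].
  have /cvg_ex[l Fl] := dF.
  rewrite derive1E; have -> : 'D_1 F z = l by apply: cvg_lim.
  (* The derivative is a limit along punctured neighbourhoods of 0, so the increments must also be
     nonzero. *)
  have hn : (fun n => n.+1%:R^-1 : R) @ \oo --> 0^'.
    move=> A hA; have H : nbhs (0 : R) (fun y : R => y != 0 -> A y) := hA.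
    have H' : \forall n \near \oo, (n.+1%:R^-1 != 0 :> R -> A n.+1%:R^-1) := @cvg_harmonic R _ H.
    by apply: filterS H' => n; apply; rewrite gt_eqF ?invr_gt0.
  have := cvg_comp _ _ hn Fl; apply: cvg_trans; apply: near_eq_cvg; apply: nearW => n /=.
  by rewrite /p /F invrK [_%:A]mulr1 [in RHS](addrC z).
- move=> n z; rewrite indicE mem_setE.
  have [_|zxy] := boolP (z \in `[x - 1, y]).
    rewrite mulr1 -(real_normK (num_real (a z - _))) lerXn2r ?nnegrE ?mulr_ge0//.
    by rewrite (le_trans (ler_normB _ _))// mulr_natl mulr2n lerD.
  rewrite p0// a0 ?subr0 ?expr0n ?mulr0//.
  apply: contra zxy; rewrite !in_itv/= => /andP[xz ->]; rewrite andbT.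
  by rewrite lerBlDr (le_trans xz)// lerDl.
exists (p n); have p2 := bounded_itv_L2 _ _ _ _ (mp n) (pM n) (p0 n); split => //.
- exact: L2_itv_L1 p2 (p0 n).
- exact: plancherel_defect_lipschitz (mp n) (pL n) (pM n) (p0 n).
Unshelve. all: by end_near. Qed.

(** Truncating the values at height n keeps the support and gives bounded functions, with an error
    dominated by |a|. *)
Lemma plancherel a (x y : R) : L2 a ->
  (forall z, z \notin `[x, y] -> a z = 0) -> plancherel_defect a = 0.
Proof.
move=> a2 a0; have a1 := L2_itv_L1 _ _ _ a2 a0; have ma := L2_measurable _ a2.
pose p n t : R := Num.max (- n%:R) (Num.min (a t) n%:R).
have mp n : measurable_fun setT (p n).
  by apply: measurable_maxr => //; exact: measurable_minr.
have pM n t : `|p n t| <= n%:R.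
  rewrite ler_norml le_max lexx/= ge_max ge_min lexx orbT andbT.
  by rewrite (@le_trans _ _ 0)// oppr_le0.
have p0 n z : z \notin `[x, y] -> p n z = 0.
  by move=> /a0; rewrite /p => ->; rewrite min_l// max_r// oppr_le0.
apply: plancherel_defect_closed => // d d0.
have pa n t : `|a t| <= n%:R -> p n t = a t.
  by rewrite ler_norml /p => /andP[an na]; rewrite min_l// max_r.
have [|||n hn] := L2_approx p a (fun t => a t ^+ 2) mp ma _ _ _ d d0.
- exact: L2_sqr.
- apply: aeW => z; apply: cvg_near_cst; near=> n; apply: pa.
  by near: n; exact: nbhs_infty_ger.
- move=> n t; rewrite -(real_normK (num_real (a t - _))) -[leRHS](real_normK (num_real _)).
  rewrite lerXn2r ?nnegrE//; have [/pa ->|] := leP `|a t| n%:R.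
    by rewrite subrr normr0.
  rewrite /p lter_normr => /orP[na|na].
    rewrite min_r ?(ltW na)// max_r; last by rewrite (@le_trans _ _ 0)// oppr_le0.
    have n0 : 0 <= n%:R :> R by []. 
    by rewrite !ger0_norm; lra.
  have n0 : 0 <= n%:R :> R by [].
  rewrite min_l; last by lra.
  rewrite max_l; last by lra.
  by rewrite !ler0_norm; lra.
exists (p n); have p2 := bounded_itv_L2 _ _ _ _ (mp n) (pM n) (p0 n); split => //.
- exact: L2_itv_L1 p2 (p0 n).
- exact: plancherel_defect_bounded (mp n) (pM n) (p0 n).
Unshelve. all: by end_near. Qed.

End Plancherel.

(** * Complex functions and Parseval identity *)

Section Complex.
Context {R : realType}.
Notation mu := (@lebesgue_measure R).
Notation Re := (@complex.Re R).
Notation Im := (@complex.Im R).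
Implicit Types (a b p q : R -> R) (f g h : R -> R[i]) (s t w M : R).

(** Removes the products of a real part with an imaginary part in [ip_fourier]. *)
Lemma integral_odd a : L1 a -> (forall x, a (- x) = - a x) -> \int[mu]_x a x = 0.
Proof.
move=> ia aN.
have E : \int[mu]_x a x = \int[mu]_x a (- x).
  rewrite /Rintegral; congr fine.
  transitivity (\int[pushforward mu (-%R : _ -> measurableTypeR R)]_t (a t)%:E)%E.
    by apply: eq_measure_integral => //= A mA _; exact/esym/lebesgue_measureN.
  rewrite integral_pushforward//=.
  - exact: (measurable_int mu ia).
  - rewrite preimage_setT (_ : _ \o _ = EFin \o (fun x => - a x)); first exact: L1N.
    by apply/funext => x /=; rewrite aN.
move: E; under [in X in _ = X]eq_Rintegral do rewrite aN -mulN1r.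
rewrite integralZ'// mulN1r; move: (\int[mu]_x _) => x; lra.
Qed.

Definition fourier_cross a p : R := \int[mu]_w (cosT a w * cosT p w + sinT a w * sinT p w).

Lemma L1_fourier_cross a p : L1 a -> L2 a -> L1 p -> L2 p ->
  L1 (fun w => cosT a w * cosT p w + sinT a w * sinT p w).
Proof.
move=> a1 a2 p1 p2; have [Ca Sa _] := bessel _ a1 a2.
by have [Cp Sp _] := bessel _ p1 p2; apply: L1D; exact: L2M.
Qed.

(* [a] need not have compact support: the defect form vanishes at [p], hence so
   does its polar form against [p]. *)
Lemma parseval_real a p : L1 a -> L2 a -> L1 p -> L2 p -> plancherel_defect p = 0 ->
  2 * pi * \int[mu]_t (a t * p t) = fourier_cross a p.
Proof.
move=> a1 a2 p1 p2 Qp0; apply/eqP; rewrite -subr_eq0 -sqrf_eq0 eq_le sqr_ge0 andbT.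
rewrite -(mulr0 (plancherel_defect a)) -Qp0; apply: discriminant_le => t.
have tp1 := L1Z t _ p1; have tp2 := L2Z t _ p2.
have := plancherel_defect_ge0 _ (L1D _ _ a1 tp1) (L2D _ _ a2 tp2); rewrite /plancherel_defect.
have -> : \int[mu]_x ((a x + t * p x) ^+ 2) = \int[mu]_x (a x ^+ 2) +
    2 * t * \int[mu]_x (a x * p x) + t ^+ 2 * \int[mu]_x (p x ^+ 2).
  rewrite -(integralZ' _ _ (L2M _ _ a2 p2)) -(integralZ' _ _ (L2_sqr _ p2)).
  rewrite -(integralD' _ _ (L2_sqr _ a2) (L1Z _ _ (L2M _ _ a2 p2))).
  rewrite -integralD'; first by apply: eq_Rintegral => x _; ring.
    by apply: L1D; [exact: L2_sqr|exact/L1Z/L2M].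
  exact/L1Z/L2_sqr.
have -> : fourier_energy (fun x => a x + t * p x) = fourier_energy a + 2 * t * fourier_cross a p + t ^+ 2 * fourier_energy p.
  have iX := L1_fourier_cross _ _ a1 a2 p1 p2; have iT := L1_fourier_energy.
  rewrite /fourier_energy /fourier_cross -(integralZ' _ _ iX) -(integralZ' _ _ (iT _ _ p1 p2)).
  rewrite -(integralD' _ _ (iT _ _ a1 a2) (L1Z _ _ iX)).
  rewrite -integralD'; last 2 first.
  - by apply: L1D; [exact: iT|exact: L1Z].
  - exact/L1Z/iT.
  apply: eq_Rintegral => w _; rewrite (cosTD _ _ _ a1 tp1) (sinTD _ _ _ a1 tp1).
  have -> : cosT (fun x => t * p x) w = t * cosT p w.
    rewrite /cosT -(integralZ' _ _ (L1_cos _ w p1)).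
    by apply: eq_Rintegral => x _; rewrite mulrA.
  have -> : sinT (fun x => t * p x) w = t * sinT p w.
    rewrite /sinT -(integralZ' _ _ (L1_sin _ w p1)).
    by apply: eq_Rintegral => x _; rewrite mulrA.
  by move: (cosT a w) (sinT a w) (cosT p w) (sinT p w) => u v y z; ring.
move: (\int[mu]_x (a x ^+ 2)) (\int[mu]_x (a x * p x)) (\int[mu]_x (p x ^+ 2)).
move: (fourier_energy a) (fourier_cross a p) (fourier_energy p) (2 * pi) => u v y z u' v' y'.
by congr (0 <= _); ring.
Qed.

Definition C1 f := L1 (Re \o f) /\ L1 (Im \o f).
Definition C2 f := L2 (Re \o f) /\ L2 (Im \o f).

(** The real part of the Hermitian product. It induces the same norm, and the pairings used later
    are real. *)
Definition ip f g : R := \int[mu]_t (Re (f t) * Re (g t) + Im (f t) * Im (g t)).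

Lemma ReD (x y : R[i]) : Re (x + y) = Re x + Re y. Proof. by case: x y => ? ? []. Qed.
Lemma ImD (x y : R[i]) : Im (x + y) = Im x + Im y. Proof. by case: x y => ? ? []. Qed.
Lemma ReB (x y : R[i]) : Re (x - y) = Re x - Re y. Proof. by case: x y => ? ? []. Qed.
Lemma ImB (x y : R[i]) : Im (x - y) = Im x - Im y. Proof. by case: x y => ? ? []. Qed.

Lemma L1_ip f g : C2 f -> C2 g -> L1 (fun t => Re (f t) * Re (g t) + Im (f t) * Im (g t)).
Proof. by move=> [f1 f2] [g1 g2]; apply: L1D; exact: L2M. Qed.

Lemma C2B f g : C2 f -> C2 g -> C2 (f \- g).
Proof.
move=> [f1 f2] [g1 g2]; split.
  by have := L2B _ _ f1 g1; congr L2; apply/funext => t /=; rewrite ReB.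
by have := L2B _ _ f2 g2; congr L2; apply/funext => t /=; rewrite ImB.
Qed.

Lemma ipC f g : ip f g = ip g f.
Proof. by apply: eq_Rintegral => t _; rewrite mulrC (mulrC (Im _)). Qed.

Lemma ipBl f g h : C2 f -> C2 g -> C2 h -> ip (f \- g) h = ip f h - ip g h.
Proof.
move=> f2 g2 h2; rewrite /ip -(integralB' _ _ (L1_ip _ _ f2 h2) (L1_ip _ _ g2 h2)).
apply: eq_Rintegral => t _ /=; rewrite ReB ImB.
by move: (Re (f t)) (Im (f t)) (Re (g t)) (Im (g t)) (Re (h t)) (Im (h t)) => *; ring.
Qed.

Lemma ipBr f g h : C2 f -> C2 g -> C2 h -> ip h (f \- g) = ip h f - ip h g.
Proof. by move=> *; rewrite ipC ipBl// ipC (ipC g). Qed.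

Lemma ip_ge0 f : 0 <= ip f f.
Proof. by apply: Rintegral_ge0 => t _; rewrite -!expr2 addr_ge0 ?sqr_ge0. Qed.

Lemma ip_cauchy f g : C2 f -> C2 g -> ip f g ^+ 2 <= ip f f * ip g g.
Proof.
move=> f2 g2; apply: discriminant_le => t.
rewrite /ip -(integralZ' _ _ (L1_ip _ _ f2 g2)) -(integralZ' _ _ (L1_ip _ _ g2 g2)).
rewrite -(integralD' _ _ (L1_ip _ _ f2 f2) (L1Z _ _ (L1_ip _ _ f2 g2))).
rewrite -integralD'; last 2 first.
- by apply: L1D; [exact: L1_ip|exact/L1Z/L1_ip].
- exact/L1Z/L1_ip.
apply: Rintegral_ge0 => x _.
move: (Re (f x)) (Im (f x)) (Re (g x)) (Im (g x)) => u v y z.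
rewrite [leRHS](_ : _ = (u + t * y) ^+ 2 + (v + t * z) ^+ 2); last by ring.
by rewrite addr_ge0 ?sqr_ge0.
Qed.

Definition nrm f : R := Num.sqrt (ip f f).

Lemma nrm_ge0 f : 0 <= nrm f. Proof. exact: sqrtr_ge0. Qed.

Lemma sqr_nrm f : nrm f ^+ 2 = ip f f. Proof. by rewrite sqr_sqrtr ?ip_ge0. Qed.

Lemma normr_ip_le f g : C2 f -> C2 g -> `|ip f g| <= nrm f * nrm g.
Proof.
move=> f2 g2; rewrite -(@ler_pXn2r _ 2)// ?nnegrE ?mulr_ge0 ?nrm_ge0//.
by rewrite real_normK ?num_real// exprMn !sqr_nrm ip_cauchy.
Qed.

Lemma nrm_triangle f g : C2 f -> C2 g -> nrm f <= nrm (f \- g) + nrm g.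
Proof.
move=> f2 g2; have d2 := C2B _ _ f2 g2.
rewrite -(@ler_pXn2r _ 2)// ?nnegrE ?addr_ge0 ?nrm_ge0//.
have := normr_ip_le _ _ d2 g2; rewrite ler_norml => /andP[_].
have : ip f f = ip (f \- g) (f \- g) + 2 * ip (f \- g) g + ip g g.
  rewrite !ipBl// !ipBr// (ipC g f); move: (ip f f) (ip f g) (ip g g) => *; ring.
rewrite sqrrD !sqr_nrm; move: (ip f f) (ip _ _) (ip _ _) (ip _ _) (nrm _ * nrm _) => *; lra.
Qed.

Lemma memLp1 f : memLp 1%:E f -> C1 f.
Proof. by move=> [/Lfun1_integrable ? /Lfun1_integrable]. Qed.

Lemma Lfun_L2 a : a \in Lfun mu 2%:E -> L2 a.
Proof.
move=> h; split; last exact: Lfun2_integrable_sqr h.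
by move: h; rewrite inE => /andP[]; rewrite inE.
Qed.

Lemma memLp2 f : memLp 2%:E f -> C2 f.
Proof. by move=> [/Lfun_L2 ? /Lfun_L2]. Qed.

Lemma cmodulus2 (z : R[i]) : cmodulus z ^+ 2 = Re z * Re z + Im z * Im z.
Proof. by case: z => x y; rewrite /cmodulus /= sqr_sqrtr ?addr_ge0 ?sqr_ge0// !expr2. Qed.

Lemma cmodulus_ge0 (z : R[i]) : 0 <= cmodulus z.
Proof. by case: z => x y; exact: sqrtr_ge0. Qed.

Lemma L2normE D f : L2norm D f =
  ((\int[mu]_(t in D) (Re (f t) * Re (f t) + Im (f t) * Im (f t))%:E) `^ 2^-1)%E.
Proof.
rewrite /L2norm unlock; congr (_ `^ _)%E; rewrite [RHS]integral_mkcond.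
apply: eq_integral => t _; rewrite !patchE; case: ifP => _; last first.
  by rewrite /= normr0 powR0.
by rewrite /= -cmodulus2 ger0_norm ?cmodulus_ge0// powR_mulrn ?cmodulus_ge0.
Qed.

Lemma L2norm_nrm f : C2 f -> L2norm setT f = (nrm f)%:E.
Proof.
move=> f2; rewrite L2normE -EFin_integral; last exact: L1_ip.
by rewrite poweR_EFin powR12_sqrt ?ip_ge0.
Qed.

Definition fourier_cst : R := (Num.sqrt (2 * pi))^-1.

Lemma sqr_fourier_cst : fourier_cst ^+ 2 = (2 * pi)^-1.
Proof. by rewrite exprVn sqr_sqrtr// mulr_ge0 ?pi_ge0. Qed.

Lemma fourier_Re f w : C1 f ->
  Re (fourier f w) = fourier_cst * (cosT (Re \o f) w + sinT (Im \o f) w).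
Proof.
move=> [f1 f2]; rewrite /fourier /cintegral /= mul0r subr0; congr (_ * _).
rewrite /cosT /sinT -(integralD' _ _ (L1_cos _ w f1) (L1_sin _ w f2)).
by apply: eq_Rintegral => t _ /=; case: (f t) => x y /=; rewrite cosN sinN mulrN opprK.
Qed.

Lemma fourier_Im f w : C1 f ->
  Im (fourier f w) = fourier_cst * (cosT (Im \o f) w - sinT (Re \o f) w).
Proof.
move=> [f1 f2]; rewrite /fourier /cintegral /= mul0r addr0; congr (_ * _).
rewrite /cosT /sinT -(integralB' _ _ (L1_cos _ w f2) (L1_sin _ w f1)).
by apply: eq_Rintegral => t _ /=; case: (f t) => x y /=; rewrite cosN sinN mulrN addrC.
Qed.

Lemma C2_fourier f : C1 f -> C2 f -> C2 (fourier f).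
Proof.
move=> f1 [r2 i2]; have [r1 i1] := f1.
have [Cr Sr _] := bessel _ r1 r2; have [Ci Si _] := bessel _ i1 i2.
split.
  rewrite (_ : _ \o _ = fun w => fourier_cst * (cosT (Re \o f) w + sinT (Im \o f) w)).
    by apply: L2Z; exact: L2D.
  by apply/funext => w; exact: fourier_Re.
rewrite (_ : _ \o _ = fun w => fourier_cst * (cosT (Im \o f) w - sinT (Re \o f) w)).
  by apply: L2Z; exact: L2B.
by apply/funext => w; exact: fourier_Im.
Qed.

Lemma cosT_even a w : cosT a (- w) = cosT a w.
Proof. by apply: eq_Rintegral => t _; rewrite mulrN cosN. Qed.

Lemma sinT_odd a w : L1 a -> sinT a (- w) = - sinT a w.
Proof.
move=> a1; rewrite /sinT -[RHS]mulN1r -(integralZ' _ _ (L1_sin _ w a1)).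
by apply: eq_Rintegral => t _; rewrite mulrN sinN mulN1r mulrN.
Qed.

(** Expanding the real part of the product leaves, besides the two cross energies, the mixed terms
    [o]. Each is a cosine transform times a sine transform, hence odd in w, and integrates to 0. *)
Lemma ip_fourier f g : C1 f -> C2 f -> C1 g -> C2 g ->
  2 * pi * ip (fourier f) (fourier g) =
  fourier_cross (Re \o f) (Re \o g) + fourier_cross (Im \o f) (Im \o g).
Proof.
move=> f1 [fr fi] g1 [gr gi]; have [fr1 fi1] := f1; have [gr1 gi1] := g1.
have [Ca Sa _] := bessel _ fr1 fr; have [Cb Sb _] := bessel _ fi1 fi.
have [Cp Sp _] := bessel _ gr1 gr; have [Cq Sq _] := bessel _ gi1 gi.
set a := Re \o f in fr fr1 Ca Sa *; set b := Im \o f in fi fi1 Cb Sb *.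
set p := Re \o g in gr gr1 Cp Sp *; set q := Im \o g in gi gi1 Cq Sq *.
have pi2 : 2 * pi != 0 :> R by rewrite mulf_neq0// gt_eqF// pi_gt0.
pose o w := (cosT a w * sinT q w + sinT b w * cosT p w) - (cosT b w * sinT p w + sinT a w * cosT q w).
have io : L1 o by apply: L1B; apply: L1D; exact: L2M.
have o0 : \int[mu]_w o w = 0.
  by apply: integral_odd => // w; rewrite /o !cosT_even !sinT_odd//; move: (cosT a w) (cosT b w)
   (cosT p w) (cosT q w) (sinT a w) (sinT b w) (sinT p w) (sinT q w) => *; ring.
have iX := L1_fourier_cross _ _ fr1 fr gr1 gr; have iY := L1_fourier_cross _ _ fi1 fi gi1 gi.
rewrite -[RHS]addr0 -o0 /fourier_cross -(integralD' _ _ iX iY) -(integralD' _ _ (L1D _ _ iX iY) io).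
rewrite -integralZ'; last by apply: L1_ip; exact: C2_fourier.
apply: eq_Rintegral => w _; rewrite !fourier_Re// !fourier_Im// /o -/a -/b -/p -/q.
rewrite [X in _ * X](_ : _ = fourier_cst ^+ 2 * ((cosT a w + sinT b w) * (cosT p w + sinT q w)
  + (cosT b w - sinT a w) * (cosT q w - sinT p w))); last first.
  move: fourier_cst (cosT a w) (cosT b w)
   (cosT p w) (cosT q w) (sinT a w) (sinT b w) (sinT p w) (sinT q w) => *; ring.
rewrite sqr_fourier_cst mulVKf//.
move: (cosT a w) (cosT b w) (cosT p w) (cosT q w) (sinT a w) (sinT b w) (sinT p w) (sinT q w) => *; ring.
Qed.

Lemma fourier_crossE a : fourier_cross a a = fourier_energy a.
Proof. by apply: eq_Rintegral => w _; rewrite !expr2. Qed.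

Lemma bessel_complex f : C1 f -> C2 f -> ip (fourier f) (fourier f) <= ip f f.
Proof.
move=> f1 f2; have := ip_fourier _ _ f1 f2 f1 f2; rewrite !fourier_crossE.
have [[r1 i1] [r2 i2]] := (f1, f2).
move=> E; have := plancherel_defect_ge0 _ r1 r2; rewrite /plancherel_defect subr_ge0 => hr.
have := plancherel_defect_ge0 _ i1 i2; rewrite /plancherel_defect subr_ge0 => hi.
have -> : ip f f = \int[mu]_t ((Re \o f) t ^+ 2) + \int[mu]_t ((Im \o f) t ^+ 2).
  rewrite -(integralD' _ _ (L2_sqr _ r2) (L2_sqr _ i2)).
  by apply: eq_Rintegral => t _; rewrite !expr2.
rewrite -(ler_pM2l (_ : 0 < 2 * pi)) ?mulr_gt0 ?pi_gt0// E mulrDr.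
exact: lerD.
Qed.

Lemma C2_supp_C1 g (x y : R) : C2 g -> (forall z, z \notin `[x, y] -> g z = 0) -> C1 g.
Proof.
move=> [r2 i2] g0; split.
  by apply: (@L2_itv_L1 _ _ x y r2) => z zxy /=; rewrite g0.
by apply: (@L2_itv_L1 _ _ x y i2) => z zxy /=; rewrite g0.
Qed.

Lemma parseval f g (x y : R) : C1 f -> C2 f -> C2 g ->
  (forall z, z \notin `[x, y] -> g z = 0) ->
  ip (fourier f) (fourier g) = ip f g.
Proof.
move=> f1 f2 g2 g0; have g1 := C2_supp_C1 _ _ _ g2 g0.
have [[fr1 fi1] [fr fi]] := (f1, f2); have [[gr1 gi1] [gr gi]] := (g1, g2).
have pi2 : 2 * pi != 0 :> R by rewrite mulf_neq0// gt_eqF// pi_gt0.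
apply: (mulfI pi2); rewrite ip_fourier//.
rewrite -!parseval_real//; last 2 first.
- by apply: (@plancherel _ _ x y gi) => z zxy /=; rewrite g0.
- by apply: (@plancherel _ _ x y gr) => z zxy /=; rewrite g0.
by rewrite -mulrDr -(integralD' _ _ (L2M _ _ fr gr) (L2M _ _ fi gi)).
Qed.

Lemma fourierL2_approx f fhat : is_fourierL2 f fhat ->
  [/\ C2 f, C2 fhat & forall d : R, 0 < d -> exists h,
  [/\ C1 h, C2 h, nrm (f \- h) <= d & nrm (fhat \- fourier h) <= d]].
Proof.
move=> [/memLp2 f2 /memLp2 fh2 [h [hL hf hfh]]]; split => // d d0.
have {}hL n : C1 (h n) /\ C2 (h n) by have [/memLp1 ? /memLp2] := hL n.
move: hf hfh => /fine_cvgP[_ /cvgrPdist_le/(_ d d0)[n1 _ H1]].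
move=> /fine_cvgP[_ /cvgrPdist_le/(_ d d0)[n2 _ H2]].
pose n := maxn n1 n2; have [h1 h2] := hL n; exists (h n); split => //.
  have := H1 n (leq_maxl _ _); rewrite /= L2norm_nrm/=; last exact: C2B.
  by rewrite sub0r normrN ger0_norm ?nrm_ge0.
have := H2 n (leq_maxr _ _); rewrite /= L2norm_nrm/=; last exact/C2B/C2_fourier.
by rewrite sub0r normrN ger0_norm ?nrm_ge0.
Qed.

(** Bessel's inequality for the integrable approximants, passed to the limit by the triangle
    inequality. *)
Lemma fourierL2_nrm f fhat : is_fourierL2 f fhat -> nrm fhat <= nrm f.
Proof.
move=> /fourierL2_approx[f2 fh2 H]; apply/ler_addgt0Pr => d d0.
have [|h [h1 h2 hf hfh]] := H (d / 2); first by rewrite divr_gt0.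
have F2 := C2_fourier _ h1 h2.
have := nrm_triangle _ _ fh2 F2.
have : nrm (fourier h) <= nrm h by rewrite ler_wsqrtr// bessel_complex.
have := nrm_triangle _ _ h2 f2.
have -> : nrm (h \- f) = nrm (f \- h).
  congr Num.sqrt; apply: eq_Rintegral => t _ /=; rewrite !ReB !ImB.
  move: (Re (f t)) (Im (f t)) (Re (h t)) (Im (h t)) => *; ring.
move: hf hfh; move: (nrm _) (nrm _) (nrm _) (nrm _) (nrm _) (nrm _) => *; lra.
Qed.

(** Both pairings are continuous in their first argument by Cauchy-Schwarz, so the identity passes
    from the integrable approximants to f. *)
Lemma fourierL2_parseval f fhat g (x y : R) : is_fourierL2 f fhat -> C2 g ->
  (forall z, z \notin `[x, y] -> g z = 0) ->
  ip fhat (fourier g) = ip f g.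
Proof.
move=> /fourierL2_approx[f2 fh2 H] g2 g0; have g1 := C2_supp_C1 _ _ _ g2 g0.
have G2 := C2_fourier _ g1 g2.
apply/eqP; rewrite -subr_eq0 -normr_le0; apply: le0_forall_gt0 => d d0.
pose M := nrm (fourier g) + nrm g + 1.
have M0 : 0 < M by rewrite ltr_wpDl// addr_ge0 ?nrm_ge0.
have [|h [h1 h2 hf hfh]] := H (d / M); first by rewrite divr_gt0.
have F2 := C2_fourier _ h1 h2.
rewrite (_ : _ - _ = ip (fhat \- fourier h) (fourier g) - ip (f \- h) g); last first.
  rewrite !ipBl// (parseval _ _ _ _ h1 h2 g2 g0).
  by move: (ip _ _) (ip _ _) (ip _ _) => *; ring.
rewrite (le_trans (ler_normB _ _))//.
have A := normr_ip_le _ _ (C2B _ _ fh2 F2) G2.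
have B := normr_ip_le _ _ (C2B _ _ f2 h2) g2.
rewrite (le_trans (lerD A B))//.
rewrite (@le_trans _ _ (d / M * nrm (fourier g) + d / M * nrm g))//.
  by rewrite lerD// ler_wpM2r// nrm_ge0.
rewrite -mulrDr mulrAC ler_pdivrMr// ler_wpM2l ?(ltW d0)//.
by rewrite lerDl.
Qed.

End Complex.

(** * Legendre polynomials *)

Section LegendrePoly.
Context {R : realType}.
Notation mu := (@lebesgue_measure R).
Notation "'\I' u" := (Rintegral mu `[-1, 1]%classic u) (at level 10, u at level 9).
Implicit Types (F G f g : R -> R) (p q : {poly R}).

Lemma continuous_integrable11 f : continuous f ->
  mu.-integrable `[-1, 1]%classic (EFin \o f).
Proof.
move=> cf; apply: continuous_compact_integrable; first exact: segment_compact.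
exact: continuous_subspaceT.
Qed.

Lemma is_derive_continuous F f : (forall x : R, is_derive x (1 : R) F (f x)) ->
  continuous F.
Proof. by move=> dF x; exact: is_derive_cvg (dF x). Qed.

Lemma is_derive_LRcontinuous F f (a b : R) : (forall x : R, is_derive x (1 : R) F (f x)) ->
  derivable_oo_LRcontinuous F a b.
Proof.
move=> dF; have cF := is_derive_continuous _ _ dF; split.
- by move=> x _; have := dF x; case.
- by apply: cvg_at_right_filter; exact: cF.
- by apply: cvg_at_left_filter; exact: cF.
Qed.

Lemma integral_by_parts11 F f G g : 
  (forall x : R, is_derive x (1 : R) F (f x)) ->
  (forall x : R, is_derive x (1 : R) G (g x)) -> continuous f -> continuous g ->
  \I (fun x => F x * g x) = F 1 * G 1 - F (-1) * G (-1) - \I (fun x => f x * G x).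
Proof.
move=> dF dG cf cg; apply: Rintegration_by_parts.
- by rewrite ltrNl opprK (lt_trans _ (ltr1n _ 2))// ltrN10 || lra.
- exact: continuous_subspaceT.
- exact: is_derive_LRcontinuous dF.
- by move=> x _; rewrite derive1E; have := dF x => ?; exact: derive_val.
- exact: continuous_subspaceT.
- exact: is_derive_LRcontinuous dG.
- by move=> x _; rewrite derive1E; have := dG x => ?; exact: derive_val.
Qed.

(** A function is carried along with the explicit list of its derivatives, so that polynomials,
    cosines and sines enter the same repeated integration by parts. *)
Definition smooth (phi : nat -> R -> R) :=
  forall m (x : R), is_derive x (1 : R) (phi m) (phi m.+1 x).

Lemma smooth_continuous phi m : smooth phi -> continuous (phi m).
Proof. by move=> sphi; exact: is_derive_continuous (sphi m). Qed.

Lemma smooth_poly p : smooth (fun m x => p^`(m).[x]).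
Proof. by move=> m x; rewrite derivnS; exact: is_derive_poly. Qed.

Lemma integral_derivn p phi k : smooth phi ->
  (forall j, (j < k)%N -> p^`(j).[1] = 0 /\ p^`(j).[-1] = 0) ->
  \I (fun x => p^`(k).[x] * phi 0%N x) = (-1) ^+ k * \I (fun x => p.[x] * phi k x).
Proof.
elim: k phi => [phi _ _|k ih phi sphi p0]; first by rewrite mul1r derivn0.
have sphi' : smooth (fun m => phi m.+1) by move=> m; exact: sphi.
under eq_Rintegral do rewrite mulrC.
have dG x : is_derive (x : R) (1 : R) (horner p^`(k)) (p^`(k.+1).[x]).
  by rewrite derivnS; exact: is_derive_poly.
rewrite (integral_by_parts11 _ _ _ _ (sphi 0%N) dG (smooth_continuous _ 1 sphi)
  (@continuous_horner R _)).
have [-> ->] := p0 k (ltnSn k); rewrite !mulr0 subrr sub0r exprS mulN1r mulNr.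
congr (- _); rewrite -(ih (fun m => phi m.+1))//; last first.
  by move=> j jk; apply: p0; rewrite ltnS ltnW.
by apply: eq_Rintegral => x _; rewrite mulrC.
Qed.

Definition rodrigues k : {poly R} := ('X^2 - 1) ^+ k.

(** Every derivation costs at most one factor X^2 - 1. At least one factor survives when j < k, so
    the boundary terms at 1 and -1 vanish. *)
Lemma derivn_rodrigues k j : (j <= k)%N -> exists q, (rodrigues k)^`(j) = ('X^2 - 1) ^+ (k - j) * q.
Proof.
elim: j => [_|j ih jk]; first by exists 1; rewrite subn0 mulr1 derivn0.
have [q qE] := ih (ltnW jk); rewrite derivnS qE subnS.
have -> : (k - j = (k - j).-1.+1)%N by rewrite prednK// subn_gt0.
set m := (k - j).-1; rewrite /=.
exists (('X^2 - 1)^`() * q *+ m.+1 + ('X^2 - 1) * q^`()).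
set Y : {poly R} := 'X^2 - 1.
rewrite derivM deriv_exp /= exprS mulrDr mulrnAl mulrnAr; congr (_ *+ _ + _).
  by rewrite (mulrC Y^`()) -mulrA.
by rewrite (mulrC Y) -mulrA.
Qed.

Lemma derivn_rodrigues_root k j : (j < k)%N ->
  (rodrigues k)^`(j).[1] = 0 /\ (rodrigues k)^`(j).[-1] = 0.
Proof.
move=> jk; have [q ->] := derivn_rodrigues _ _ (ltnW jk).
by split; rewrite !hornerE ?sqrrN expr1n subrr expr0n subn_eq0 leqNgt jk mul0r.
Qed.

Definition rodrigues_cst k : R := (2 ^+ k * k`!%:R)^-1.

Lemma rodrigues_cst_gt0 k : 0 < rodrigues_cst k.
Proof. by rewrite invr_gt0 mulr_gt0 ?exprn_gt0// ltr0n fact_gt0. Qed.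

Lemma legendreE k : legendre R k = rodrigues_cst k *: (rodrigues k)^`(k). Proof. by []. Qed.

Lemma horner_rodrigues k x : (rodrigues k).[x] = (-1) ^+ k * (1 - x ^+ 2) ^+ k.
Proof. by rewrite -exprMn mulN1r opprB !hornerE. Qed.

Lemma continuous_onem_sqrX k : continuous (fun x : R => (1 - x ^+ 2) ^+ k).
Proof.
move=> x; have := @continuous_horner R ((1 - 'X^2) ^+ k) x.
by rewrite (_ : horner _ = fun x : R => (1 - x ^+ 2) ^+ k)//; apply/funext => y; rewrite !hornerE.
Qed.

(** The sign (-1)^k of the k integrations by parts cancels the one in (x^2 - 1)^k = (-1)^k (1 -
    x^2)^k, leaving a nonnegative weight on [-1, 1]. *)
Lemma integral_legendre k phi : smooth phi ->
  \I (fun x => (legendre R k).[x] * phi 0%N x) =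
  rodrigues_cst k * \I (fun x => (1 - x ^+ 2) ^+ k * phi k x).
Proof.
move=> sphi; rewrite legendreE.
under eq_Rintegral do rewrite hornerZ -mulrA.
rewrite RintegralZl//; last first.
  apply: continuous_integrable11 => x; apply: cvgM; first exact: continuous_horner.
  exact: smooth_continuous.
congr (_ * _); rewrite integral_derivn//; last by move=> j; exact: derivn_rodrigues_root.
under eq_Rintegral do rewrite horner_rodrigues -mulrA.
rewrite RintegralZl//; last first.
  apply: continuous_integrable11 => x; apply: cvgM; first exact: continuous_onem_sqrX.
  exact: smooth_continuous.
by rewrite mulrA -exprMn mulrNN mulr1 expr1n mul1r.
Qed.

Lemma legendre_orth_small k p : (size p <= k)%N ->
  \I (fun x => (legendre R k).[x] * p.[x]) = 0.
Proof.
move=> pk; have := integral_legendre k _ (smooth_poly p); rewrite /= => ->.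
rewrite derivn_poly0//; under eq_Rintegral do rewrite horner0 mulr0.
by rewrite /Rintegral integral0 mulr0.
Qed.

Definition onem_sqr_int k : R := \I (fun x => (1 - x ^+ 2) ^+ k).

Lemma onem_sqr_int0 : onem_sqr_int 0 = 2.
Proof.
rewrite /onem_sqr_int; under eq_Rintegral do rewrite expr0.
rewrite Rintegral_cst//= lebesgue_measure_itv/= lte_fin.
by rewrite ifT ?mul1r/=; lra.
Qed.

(** Let J be the integral of x^2 (1 - x^2)^k. Integration by parts against 1 gives I_{k+1} = (2k +
    2) J, splitting off one factor gives I_{k+1} = I_k - J, and J is eliminated. *)
Lemma onem_sqr_intS k : (2 * k%:R + 3) * onem_sqr_int k.+1 = (2 * k%:R + 2) * onem_sqr_int k.
Proof.
have c1 := continuous_onem_sqrX.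
have dF (x : R) : is_derive x (1 : R) (fun x : R => (1 - x ^+ 2) ^+ k.+1)
   (- (2 * k%:R + 2) * (x * (1 - x ^+ 2) ^+ k)).
  have := is_derive_poly ((1 - 'X^2) ^+ k.+1 : {poly R}) x.
  rewrite (_ : horner _ = fun x : R => (1 - x ^+ 2) ^+ k.+1); last first.
    by apply/funext => y; rewrite !hornerE.
  have -> : ((1 - 'X^2) ^+ k.+1)^`().[x] = - (x *+ 2) * (1 - x ^+ 2) ^+ k *+ k.+1.
    rewrite deriv_exp derivB derivXn -polyC1 derivC sub0r.
    by rewrite hornerMn hornerM hornerN hornerMn /= expr1 horner_exp !hornerE.
  move=> h; apply: (is_derive_eq h).
  rewrite -[_ *+ k.+1]mulr_natr -[x *+ 2]mulr_natr -[k.+1%:R]natr1.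
  by move: ((1 - x ^+ 2) ^+ k) (k%:R : R) => u v; ring.
have E : onem_sqr_int k.+1 = (2 * k%:R + 2) * \I (fun x => x ^+ 2 * (1 - x ^+ 2) ^+ k).
  have dG (x : R) : is_derive x (1 : R) (@id R) (1 : R) by exact: is_derive_id.
  rewrite /onem_sqr_int; under eq_Rintegral do rewrite -[_ ^+ k.+1]mulr1.
  rewrite (@integral_by_parts11 _ _ id (cst 1) dF dG)//; last 2 first.
  - move=> x; apply: cvgM; first exact: cvg_cst.
    by apply: cvgM; [exact: cvg_id|exact: c1].
  - by move=> x; exact: cvg_cst.
  rewrite sqrrN expr1n subrr expr0n !mul0r subrr sub0r.
  rewrite -RintegralZl//; last first.
    apply: continuous_integrable11 => x; apply: cvgM; last exact: c1.
    exact: exprn_continuous.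
  rewrite -[LHS]mulN1r -RintegralZl//; last first.
    apply: continuous_integrable11 => x; apply: cvgM; last exact: cvg_id.
    apply: cvgM; first exact: cvg_cst.
    by apply: cvgM; [exact: cvg_id|exact: c1].
  apply: eq_Rintegral => x _ /=; move: ((1 - x ^+ 2) ^+ k) (k%:R : R) => u v; ring.
have D : onem_sqr_int k.+1 = onem_sqr_int k - \I (fun x => x ^+ 2 * (1 - x ^+ 2) ^+ k).
  rewrite /onem_sqr_int -RintegralB//; last 2 first.
  - exact/continuous_integrable11/c1.
  - apply: continuous_integrable11 => x; apply: cvgM; last exact: c1.
    exact: exprn_continuous.
  apply: eq_Rintegral => x _; rewrite exprS; move: ((1 - x ^+ 2) ^+ k) => u; ring.
move: E D; move: (\I _) (onem_sqr_int k.+1) (onem_sqr_int k) (k%:R : R) => u v y z E D.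
have : u = y - v by rewrite D; ring.
by move=> h; move: E; rewrite h => E; rewrite mulrDl; nra.
Qed.

(* This is 2 / (1 3 5 ... (2k + 1)). *)
Definition legendre_bound k : R := rodrigues_cst k * onem_sqr_int k.

Lemma legendre_bound0 : legendre_bound 0 = 2.
Proof. by rewrite /legendre_bound onem_sqr_int0 /rodrigues_cst expr0 fact0 mul1r invr1 mul1r. Qed.

Lemma legendre_boundS k : legendre_bound k.+1 = legendre_bound k / (2 * k%:R + 3).
Proof.
have k3 : 2 * k%:R + 3 != 0 :> R by rewrite gt_eqF// ltr_wpDl// mulr_ge0.
apply: (mulIf k3); rewrite divfK// /legendre_bound -mulrA [onem_sqr_int _ * _]mulrC onem_sqr_intS mulrA; congr (_ * _).
rewrite /rodrigues_cst exprS factS natrM -[k.+1%:R]natr1.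
have f0 : k`!%:R != 0 :> R by rewrite pnatr_eq0 -lt0n fact_gt0.
have t0 : 2 ^+ k != 0 :> R by rewrite expf_neq0// pnatr_eq0.
have k1 : k%:R + 1 != 0 :> R by rewrite natr1 pnatr_eq0.
by move: f0 t0 k1; move: (k`!%:R : R) (2 ^+ k : R) (k%:R : R) => u v y *; field; apply/and3P.
Qed.

Lemma legendre_bound_gt0 k : 0 < legendre_bound k.
Proof.
elim: k => [|k ih]; first by rewrite legendre_bound0.
by rewrite legendre_boundS divr_gt0// ltr_wpDl// mulr_ge0.
Qed.

Lemma size_rodrigues k : size (rodrigues k) = k.*2.+1.
Proof.
have s3 : size ('X^2 - 1 : {poly R}) = 3%N by rewrite size_XnsubC.
have /prednK <- : (0 < size (rodrigues k))%N.
  by rewrite size_poly_gt0 expf_neq0// -size_poly_gt0 s3.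
by rewrite size_exp s3 mul2n.
Qed.

Lemma coef_rodrigues_max k : (rodrigues k)`_(k.*2) = 1.
Proof.
have := lead_coef_exp ('X^2 - 1 : {poly R}) k.
by rewrite lead_coefE size_rodrigues /= => ->; rewrite -polyC1 (monicP (monicXnsubC _ _))// expr1n.
Qed.

Lemma derivn_legendre k : (legendre R k)^`(k) = (rodrigues_cst k * (k.*2)`!%:R)%:P.
Proof.
apply/polyP => i; rewrite legendreE derivnZ coefZ !coef_derivn coefC -mulrnA.
have [->|i0] := eqVneq i 0%N; last first.
  by rewrite nth_default ?mul0rn ?mulr0// size_rodrigues; move: i0; rewrite -lt0n; lia.
have := ffact_fact (leq_addr k k); rewrite addnK addnn => <-.
by rewrite !addn0 addnn coef_rodrigues_max ffactnn.
Qed.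

(** Rodrigues' formula is applied with P_k itself as test function: its k-th derivative is constant,
    so the integral is an explicit product, evaluated by induction on k. *)
Lemma legendre_sqr k : \I (fun x => (legendre R k).[x] * (legendre R k).[x]) =
  (k%:R + 2^-1)^-1.
Proof.
have := integral_legendre k _ (smooth_poly (legendre R k)); rewrite /= => ->.
rewrite derivn_legendre; under eq_Rintegral do rewrite hornerC mulrC.
rewrite RintegralZl//; last exact/continuous_integrable11/continuous_onem_sqrX.
rewrite -/(onem_sqr_int k) mulrCA -/(legendre_bound k) mulrAC.
elim: k => [|k ih].
  by rewrite legendre_bound0 /rodrigues_cst expr0 fact0 /= mul1r invr1; field.
have k1 : k%:R + 1 != 0 :> R by rewrite natr1 pnatr_eq0.
have k2 : 2 * k%:R + 1 != 0 :> R by rewrite gt_eqF// ltr_wpDl// mulr_ge0.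
have k3 : 2 * k%:R + 3 != 0 :> R by rewrite gt_eqF// ltr_wpDl// mulr_ge0.
have k4 : k%:R + 2^-1 != 0 :> R by rewrite gt_eqF// ltr_wpDl// invr_gt0.
have k5 : (k%:R + 1) + 2^-1 != 0 :> R by rewrite gt_eqF// ltr_wpDl// ?invr_gt0// addr_ge0.
rewrite (_ : rodrigues_cst k.+1 = rodrigues_cst k / (2 * (k%:R + 1))); last first.
  rewrite /rodrigues_cst exprS factS natrM -[k.+1%:R]natr1.
  have f0 : k`!%:R != 0 :> R by rewrite pnatr_eq0 -lt0n fact_gt0.
  have t0 : 2 ^+ k != 0 :> R by rewrite expf_neq0// pnatr_eq0.
  by move: f0 t0 k1; move: (k`!%:R : R) (2 ^+ k : R) (k%:R : R) => u v y *; field; apply/and3P.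
rewrite legendre_boundS doubleS !factS !natrM -[k.*2.+2%:R]natr1 -[k.*2.+1%:R]natr1 -[k.+1%:R]natr1.
rewrite [k.*2%:R](_ : _ = 2 * k%:R); last by rewrite -mul2n natrM.
transitivity ((rodrigues_cst k * legendre_bound k * (k.*2)`!%:R) * (2 * k%:R + 1) / (2 * k%:R + 3)).
  by move: (rodrigues_cst k) (legendre_bound k) (k.*2`!%:R : R) (k%:R : R) k1 k3 => u v y z *; field; apply/andP.
rewrite ih; move: (k%:R : R) k1 k2 k3 k4 k5 => z _ _ _ z4 z5.
rewrite (_ : 2 * z + 1 = 2 * (z + 2^-1)); last by field.
rewrite (_ : 2 * z + 3 = 2 * (z + 1 + 2^-1)); last by field.
by move: (z + 2^-1) (z + 1 + 2^-1) z4 z5 => u v u0 v0; field; apply/andP.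
Qed.

Lemma size_legendre k : (size (legendre R k) <= k.+1)%N.
Proof.
apply/leq_sizeP => i ki; rewrite legendreE coefZ coef_derivn nth_default ?mul0rn ?mulr0//.
by rewrite size_rodrigues; lia.
Qed.

Lemma coef_legendre_neq0 k : (legendre R k)`_k != 0.
Proof.
rewrite legendreE coefZ coef_derivn addnn coef_rodrigues_max mulf_neq0//.
  by rewrite gt_eqF// rodrigues_cst_gt0.
by rewrite pnatr_eq0 -lt0n ffact_gt0 -addnn leq_addr.
Qed.

(** As P_K has degree exactly K, a multiple of it cancels the top coefficient and the degree
    drops. *)
Lemma legendre_span K p : (size p <= K)%N ->
  exists d : nat -> R, p = \sum_(0 <= k < K) d k *: legendre R k.
Proof.
elim: K p => [p|K ih p pK].
  by rewrite leqn0 size_poly_eq0 => /eqP ->; exists (fun=> 0); rewrite big_nil.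
pose a := p`_K / (legendre R K)`_K.
have [|d dE] := ih (p - a *: legendre R K).
  apply/leq_sizeP => i; rewrite leq_eqVlt => /predU1P[<-|Ki].
    by rewrite coefB coefZ divfK ?subrr// coef_legendre_neq0.
  rewrite coefB coefZ !nth_default ?mulr0 ?subr0//.
    exact: leq_trans (size_legendre K) _.
  exact: leq_trans pK _.
exists (fun k => if k == K then a else d k).
rewrite big_nat_recr//= eqxx -[LHS](subrK (a *: legendre R K)) dE; congr (_ + _).
by rewrite !big_nat; apply: eq_bigr => k /andP[_ kK]; rewrite ltn_eqF.
Qed.

End LegendrePoly.

(** * Orthonormal expansions *)

Section Orthonormal.
Context {R : realType}.
Notation mu := (@lebesgue_measure R).
Implicit Types (a b : R -> R) (d : nat -> R).
Variable e : nat -> R -> R.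
Hypothesis e2 : forall k, L2 (e k).
Hypothesis eO : forall i j, \int[mu]_t (e i t * e j t) = (i == j)%:R.

Definition lincomb d N (t : R) : R := \sum_(0 <= k < N) d k * e k t.
Definition coef a k : R := \int[mu]_t (a t * e k t).

Lemma lincombS d N t : lincomb d N.+1 t = lincomb d N t + d N * e N t.
Proof. by rewrite /lincomb big_nat_recr. Qed.

Lemma L2_lincomb d N : L2 (lincomb d N).
Proof.
elim: N => [|N ih].
  rewrite (_ : lincomb d 0 = fun t => 0 * e 0%N t); first exact: L2Z.
  by apply/funext => t; rewrite /lincomb big_nil mul0r.
rewrite (_ : lincomb d N.+1 = fun t => lincomb d N t + d N * e N t).
  by apply: L2D => //; exact: L2Z.
by apply/funext => t; rewrite lincombS.
Qed.

Lemma integral_lincomb a d N : L2 a ->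
  \int[mu]_t (a t * lincomb d N t) = \sum_(0 <= k < N) d k * coef a k.
Proof.
move=> a2; elim: N => [|N ih].
  under eq_Rintegral do rewrite /lincomb big_nil mulr0.
  by rewrite big_nil /Rintegral integral0.
rewrite big_nat_recr//= -ih -(integralZ' _ _ (L2M _ _ a2 (e2 N))).
rewrite -(integralD' _ _ (L2M _ _ a2 (L2_lincomb d N)) (L1Z _ _ (L2M _ _ a2 (e2 N)))).
by apply: eq_Rintegral => t _; rewrite lincombS mulrDr mulrCA.
Qed.

Lemma coef_e j k : coef (e j) k = (j == k)%:R. Proof. exact: eO. Qed.

Lemma coef_lincomb d N j : coef (lincomb d N) j = if (j < N)%N then d j else 0.
Proof.
rewrite /coef; under eq_Rintegral do rewrite mulrC.
rewrite integral_lincomb//; case: ifPn => [jN|]; last first.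
  rewrite -leqNgt => Nj; rewrite big_nat big1// => k kN.
  by rewrite coef_e gtn_eqF ?mulr0//; lia.
rewrite (bigD1_seq j) ?mem_index_iota ?iota_uniq//= coef_e eqxx mulr1 big1 ?addr0// => k.
by move=> kj; rewrite coef_e eq_sym (negbTE kj) mulr0.
Qed.

Lemma coefB a b k : L2 a -> L2 b -> coef (fun t => a t - b t) k = coef a k - coef b k.
Proof.
move=> a2 b2; rewrite /coef -(integralB' _ _ (L2M _ _ a2 (e2 k)) (L2M _ _ b2 (e2 k))).
by apply: eq_Rintegral => t _; rewrite mulrBl.
Qed.

(** The choice of [d] matters only in the last sum, which is zero for [d = coef a]: this gives both
    the norm of the residual and its minimality. *)
Lemma norm_sub_lincomb a d N : L2 a ->
  \int[mu]_t ((a t - lincomb d N t) ^+ 2) = \int[mu]_t (a t ^+ 2)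
   - \sum_(0 <= k < N) coef a k ^+ 2 + \sum_(0 <= k < N) (coef a k - d k) ^+ 2.
Proof.
move=> a2; elim: N => [|N ih].
  rewrite !big_nil subr0 addr0; apply: eq_Rintegral => t _.
  by rewrite /lincomb big_nil subr0.
pose b t := a t - lincomb d N t.
have b2 : L2 b by apply: L2B => //; exact: L2_lincomb.
have : coef b N = coef a N.
  by rewrite coefB//; [rewrite coef_lincomb ltnn subr0|exact: L2_lincomb].
have -> : \int[mu]_t ((a t - lincomb d N.+1 t) ^+ 2) =
    \int[mu]_t (b t ^+ 2) - (2 * d N) * coef b N + d N ^+ 2 * coef (e N) N.
  rewrite /coef -(integralZ' _ _ (L2M _ _ b2 (e2 N))).
  rewrite -(integralZ' _ _ (L2M _ _ (e2 N) (e2 N))).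
  rewrite -(integralB' _ _ (L2_sqr _ b2) (L1Z _ _ (L2M _ _ b2 (e2 N)))).
  rewrite -integralD'; last 2 first.
  - by apply: L1B; [exact: L2_sqr|exact/L1Z/L2M].
  - exact/L1Z/L2M.
  apply: eq_Rintegral => t _; rewrite lincombS /b.
  by move: (a t) (lincomb d N t) (d N) (e N t) => u v y z; ring.
rewrite /b ih coef_e eqxx => ->; rewrite !big_nat_recr//=.
move: (\int[mu]_t _) (\sum_(0 <= k < N) _) (\sum_(0 <= k < N) _) (coef a N) (d N) => u v y z x.
ring.
Qed.

Definition residual N a t : R := a t - lincomb (coef a) N t.

Lemma L2_residual N a : L2 a -> L2 (residual N a).
Proof. by move=> a2; apply: L2B => //; exact: L2_lincomb. Qed.

Lemma coef_residual N a j : L2 a -> (j < N)%N -> coef (residual N a) j = 0.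
Proof.
by move=> a2 jN; rewrite coefB//; [rewrite coef_lincomb jN subrr|exact: L2_lincomb].
Qed.

Lemma norm_residual N a : L2 a -> \int[mu]_t (residual N a t ^+ 2) =
  \int[mu]_t (a t ^+ 2) - \sum_(0 <= k < N) coef a k ^+ 2.
Proof.
move=> a2; rewrite norm_sub_lincomb// [X in _ + X]big1 ?addr0// => k _.
by rewrite subrr expr0n.
Qed.

Lemma norm_residual_le N a d : L2 a -> \int[mu]_t (residual N a t ^+ 2) <=
  \int[mu]_t ((a t - lincomb d N t) ^+ 2).
Proof.
by move=> a2; rewrite norm_residual// norm_sub_lincomb// lerDl sumr_ge0// => k _; exact: sqr_ge0.
Qed.

Lemma norm_residual_tail N K a : L2 a -> (N <= K)%N -> \int[mu]_t (residual N a t ^+ 2) =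
  \int[mu]_t (residual K a t ^+ 2) + \sum_(N <= k < K) coef a k ^+ 2.
Proof.
move=> a2 NK; rewrite !norm_residual// (big_cat_nat (leq0n N) NK)/=.
move: (\int[mu]_t _) (\sum_(0 <= k < N) _) (\sum_(N <= k < K) _) => u v w; ring.
Qed.

(** A residual is orthogonal to the first N functions, so [b] may be replaced by its own residual.
    Both <f, g> = |g|^2 and the smallness of the transform of g at low frequencies rest on this. *)
Lemma integral_residual N a b : L2 a -> L2 b -> 
  \int[mu]_t (residual N a t * b t) = \int[mu]_t (residual N a t * residual N b t).
Proof.
move=> a2 b2; have r2 := L2_residual N _ a2.
rewrite [RHS](_ : _ = \int[mu]_t (residual N a t * b t - residual N a t * lincomb (coef b) N t)).
  rewrite (integralB' _ _ (L2M _ _ r2 b2) (L2M _ _ r2 (L2_lincomb _ _))).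
  rewrite integral_lincomb// big_nat big1 ?subr0// => k kN.
  by rewrite coef_residual ?mulr0//; case/andP: kN.
by apply: eq_Rintegral => t _; rewrite -mulrBr.
Qed.

End Orthonormal.

(** * Legendre functions on the line; Legendre coefficients and Taylor approximation of cosines and
    sines *)

Section LegendreBasis.
Context {R : realType}.
Notation mu := (@lebesgue_measure R).
Notation "'\I' u" := (Rintegral mu `[-1, 1]%classic u) (at level 10, u at level 9).

(** Closed interval, like the domain of [inner11], whereas [ind11] is the indicator of the open one;
    [integral_oo_cc] reconciles them. *)
Definition chi (t : R) : R := \1_(`[-1, 1]%classic : set R) t.
Definition legendreL k (t : R) : R := chi t * (Num.sqrt (k%:R + 2^-1) * (legendre R k).[t]).

Lemma chiE t : chi t = (t \in `[-1, 1])%:R.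
Proof. by rewrite /chi indicE mem_setE. Qed.

Lemma chi_sqr t : chi t * chi t = chi t.
Proof. by rewrite chiE; case: (_ \in _); rewrite ?mulr1 ?mulr0. Qed.

Lemma integral_chi u : \int[mu]_t (chi t * u t) = \I u.
Proof. by rewrite -integral_indic'. Qed.

Lemma L2_chi u : continuous u -> L2 (fun t => chi t * u t).
Proof.
move=> cu; split.
  apply: measurable_funM; first exact: measurable_indic.
  exact: continuous_measurable_fun.
rewrite (_ : (fun t => _) = fun t => chi t * (u t) ^+ 2); last first.
  by apply/funext => t; rewrite exprMn expr2 chi_sqr.
have : mu.-integrable `[-1, 1]%classic (EFin \o (fun t => u t ^+ 2)).
  by apply: continuous_integrable11 => x; apply: cvgM; exact: cu.
rewrite integrable_mkcond//; congr (_.-integrable _ _); apply/funext => t.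
by rewrite patchE /= chiE mem_setE/=; case: (_ \in _); rewrite ?mul1r ?mul0r.
Qed.

Lemma continuous_legendreL k : continuous (fun t => Num.sqrt (k%:R + 2^-1) * (legendre R k).[t]).
Proof. by move=> t; apply: cvgM; [exact: cvg_cst|exact: continuous_horner]. Qed.

Lemma L2_legendreL k : L2 (legendreL k).
Proof. exact/L2_chi/continuous_legendreL. Qed.

Lemma legendreL_orthonormal i j : \int[mu]_t (legendreL i t * legendreL j t) = (i == j)%:R.
Proof.
have h k : 0 < k%:R + 2^-1 :> R by rewrite ltr_wpDl// invr_gt0.
transitivity ((Num.sqrt (i%:R + 2^-1) * Num.sqrt (j%:R + 2^-1)) *
    \I (fun t => (legendre R i).[t] * (legendre R j).[t])).
  rewrite -RintegralZl//; last first.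
    by apply: continuous_integrable11 => x; apply: cvgM; exact: continuous_horner.
  rewrite -integral_chi; apply: eq_Rintegral => t _; rewrite /legendreL.
  rewrite mulrACA chi_sqr; congr (_ * _); rewrite mulrACA//.
have [->|ij] := eqVneq i j.
  by rewrite legendre_sqr -expr2 sqr_sqrtr ?ltW// mulfV// gt_eqF.
have [lij|] := ltnP i j.
  under eq_Rintegral do rewrite mulrC.
  by rewrite legendre_orth_small ?mulr0//; exact: leq_trans (size_legendre i) _.
rewrite leq_eqVlt eq_sym (negbTE ij)/= => ji.
by rewrite legendre_orth_small ?mulr0//; exact: leq_trans (size_legendre j) _.
Qed.

Lemma poly_lincomb K (p : {poly R}) : (size p <= K)%N ->
  exists d, forall t, chi t * p.[t] = lincomb legendreL d K t.
Proof.
move=> pK; have [d pE] := legendre_span _ _ pK.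
exists (fun k => d k / Num.sqrt (k%:R + 2^-1)) => t.
rewrite [in LHS]pE horner_sum mulr_sumr; apply: eq_bigr => k _.
rewrite hornerZ /legendreL [RHS]mulrCA; congr (_ * _); rewrite mulrA divfK//.
Qed.

Definition cos11 (w t : R) : R := chi t * cos (t * w).
Definition sin11 (w t : R) : R := chi t * sin (t * w).

Lemma continuous_cosM w : continuous (fun t : R => cos (t * w)).
Proof.
move=> x; apply: continuous_comp; [exact: mulrr_continuous|exact: continuous_cos].
Qed.

Lemma continuous_sinM w : continuous (fun t : R => sin (t * w)).
Proof.
move=> x; apply: continuous_comp; [exact: mulrr_continuous|exact: continuous_sin].
Qed.

Lemma L2_cos11 w : L2 (cos11 w). Proof. exact/L2_chi/continuous_cosM. Qed.
Lemma L2_sin11 w : L2 (sin11 w). Proof. exact/L2_chi/continuous_sinM. Qed.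

(** Writing a derivation as a phase shift by pi / 2 gives one formula for all orders, with the same
    phase for the cosine and the sine. *)
Lemma smooth_cos (w : R) : smooth (fun m t => w ^+ m * cos (t * w + (pi / 2) *+ m)).
Proof.
move=> m x /=; rewrite [(pi / 2) *+ m.+1]mulrSr addrA cosDpihalf exprS.
apply: is_derive_eq; rewrite /GRing.scale/=.
by move: (sin _) => u; ring.
Qed.

Lemma smooth_sin (w : R) : smooth (fun m t => w ^+ m * sin (t * w + (pi / 2) *+ m)).
Proof.
move=> m x /=; rewrite [(pi / 2) *+ m.+1]mulrSr addrA sinDpihalf exprS.
apply: is_derive_eq; rewrite /GRing.scale/=.
by move: (cos _) => u; ring.
Qed.

Lemma cauchy11 (v u : R -> R) : continuous v -> continuous u ->
  (forall t, t \in `[-1, 1] -> 0 <= v t) ->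
  (\I (fun t => v t * u t)) ^+ 2 <= \I v * \I (fun t => v t * u t ^+ 2).
Proof.
move=> cv cu v0; apply: discriminant_le => s.
have c1 : continuous (fun t => v t * u t) by move=> x; apply: cvgM; [exact: cv|exact: cu].
have c2 : continuous (fun t => v t * u t ^+ 2).
  by move=> x; apply: cvgM; [exact: cv|apply: cvgM; exact: cu].
have c1s : continuous (fun t => 2 * s * (v t * u t)).
  by move=> x; apply: cvgM; [exact: cvg_cst|exact: c1].
have c2s : continuous (fun t => s ^+ 2 * (v t * u t ^+ 2)).
  by move=> x; apply: cvgM; [exact: cvg_cst|exact: c2].
rewrite -!RintegralZl//; [|exact: continuous_integrable11|exact: continuous_integrable11].
rewrite -!RintegralD//; try exact: continuous_integrable11; last first.
  by apply: continuous_integrable11 => x; apply: cvgD; [exact: cv|exact: c1s].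
apply: Rintegral_ge0 => t t1.
rewrite (_ : _ + _ = v t * (1 + s * u t) ^+ 2); last by move: (v t) (u t) => x y; ring.
by rewrite mulr_ge0 ?sqr_ge0// v0.
Qed.

(** After Rodrigues' formula the two coefficients are integrals of cos and sin of a common phase
    against the weight (1 - t^2)^k. Cauchy-Schwarz for this weight followed by cos^2 + sin^2 = 1
    saves the factor 2 that bounding each of them by 1 would cost. *)
Lemma coef_cos11_sin11 k w :
  coef legendreL (cos11 w) k ^+ 2 + coef legendreL (sin11 w) k ^+ 2 <=
  (k%:R + 2^-1) * (legendre_bound k ^+ 2 * w ^+ k.*2).
Proof.
pose v (t : R) := (1 - t ^+ 2) ^+ k.
pose th (t : R) := t * w + (pi / 2) *+ k.
have cth : continuous th.
  by move=> x; apply: cvgD; [exact: mulrr_continuous|exact: cvg_cst].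
have cv : continuous v := continuous_onem_sqrX k.
have v0 (t : R) : t \in `[-1, 1] -> 0 <= v t.
  rewrite in_itv/= => t1; apply: exprn_ge0; rewrite subr_ge0.
  by rewrite -(real_normK (num_real t)) expr_le1// ler_norml.
have cc : continuous (fun t => cos (th t)).
  by move=> x; apply: continuous_comp; [exact: cth|exact: continuous_cos].
have cs : continuous (fun t => sin (th t)).
  by move=> x; apply: continuous_comp; [exact: cth|exact: continuous_sin].
have h0 : 0 <= k%:R + 2^-1 :> R by rewrite addr_ge0// invr_ge0.
have E (f : R -> R) (F : R -> R) : continuous f -> continuous F -> 
    \I (fun t => (legendre R k).[t] * f t) = rodrigues_cst k * \I (fun t => v t * (w ^+ k * F t)) ->
    coef legendreL (fun t => chi t * f t) k = Num.sqrt (k%:R + 2^-1) * (rodrigues_cst k * (w ^+ k * \I (fun t => v t * F t))).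
  move=> cf cF E; rewrite -RintegralZl//; last first.
    by apply: continuous_integrable11 => x; apply: cvgM; [exact: cv|exact: cF].
  under [X in rodrigues_cst k * X]eq_Rintegral do rewrite mulrCA.
  rewrite -E -RintegralZl//; last first.
    by apply: continuous_integrable11 => x; apply: cvgM; [exact: continuous_horner|exact: cf].
  rewrite -integral_chi; apply: eq_Rintegral => t _.
  by rewrite /legendreL mulrACA chi_sqr; congr (_ * _); rewrite mulrCA (mulrC (f t)).
rewrite (E _ _ (continuous_cosM w) cc); last first.
  have := integral_legendre k _ (smooth_cos w).
  by under eq_Rintegral do rewrite expr0 mul1r mulr0n addr0.
rewrite (E _ _ (continuous_sinM w) cs); last first.
  have := integral_legendre k _ (smooth_sin w).
  by under eq_Rintegral do rewrite expr0 mul1r mulr0n addr0.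
have cauc := cauchy11 _ _ cv cc v0; have caus := cauchy11 _ _ cv cs v0.
have S : (\I (fun t => v t * cos (th t))) ^+ 2 + (\I (fun t => v t * sin (th t))) ^+ 2
    <= onem_sqr_int k ^+ 2.
  apply: (le_trans (lerD cauc caus)); rewrite -mulrDr -RintegralD//; last 2 first.
  - by apply: continuous_integrable11 => x; apply: cvgM; [exact: cv|apply: cvgM; exact: cc].
  - by apply: continuous_integrable11 => x; apply: cvgM; [exact: cv|apply: cvgM; exact: cs].
  under [X in _ * X]eq_Rintegral do rewrite -mulrDr cos2Dsin2 mulr1.
  by rewrite expr2.
rewrite !exprMn sqr_sqrtr// -mulrDr ler_wpM2l// -mulrDr -mulrDr.
rewrite -exprM muln2 -[leRHS]mulrA ler_wpM2l ?sqr_ge0// mulrC ler_wpM2r//.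
by rewrite -muln2 exprM sqr_ge0.
Qed.

Lemma series_tail (u v : nat -> R) (lu lv : R) n :
  series u @ \oo --> lu -> series v @ \oo --> lv -> (forall i, `|u i| <= v i) ->
  `|lu - series u n| <= lv - series v n.
Proof.
move=> ulu vlv uv.
have h1 : (fun m => `|series u m - series u n|) @ \oo --> `|lu - series u n|.
  by apply: cvg_norm; apply: cvgB => //; exact: cvg_cst.
have h2 : (fun m => series v m - series v n) @ \oo --> lv - series v n.
  by apply: cvgB => //; exact: cvg_cst.
apply: (ler_cvg_to h1 h2); near=> m; rewrite !sub_series_geq; last 2 first.
  + by near: m; exact: nbhs_infty_ge.
  + by near: m; exact: nbhs_infty_ge.
  by rewrite (le_trans (ler_norm_sum _ _ _))// ler_sum.
Unshelve. all: by end_near. Qed.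

(** Replaces the tail at |tw| by the one at |w|, which makes the Taylor approximation uniform in t
    on [-1, 1]. *)
Lemma exp_tail (y z : R) n : 0 <= y -> y <= z ->
  expR y - series (exp_coeff y) n <= expR z - series (exp_coeff z) n.
Proof.
move=> y0 yz.
have h (x : R) : (fun m => series (exp_coeff x) m - series (exp_coeff x) n) @ \oo -->
    expR x - series (exp_coeff x) n.
  by apply: cvgB; [exact: is_cvg_series_exp_coeff|exact: cvg_cst].
apply: (ler_cvg_to (h y) (h z)); near=> m; rewrite !sub_series_geq; last 2 first.
  + by near: m; exact: nbhs_infty_ge.
  + by near: m; exact: nbhs_infty_ge.
  by rewrite ler_sum// => i _; rewrite /exp_coeff /= ler_wpM2r// lerXn2r// nnegrE (le_trans y0).
Unshelve. all: by end_near. Qed.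

Lemma cos_sin_poly (w d : R) : 0 < d -> exists K (p q : {poly R}),
  [/\ (size p <= K)%N, (size q <= K)%N,
   forall t : R, t \in `[-1, 1] -> `|cos (t * w) - p.[t]| <= d &
   forall t : R, t \in `[-1, 1] -> `|sin (t * w) - q.[t]| <= d].
Proof.
move=> d0.
have [K _ /(_ K (leqnn K)) HK] : \forall n \near \oo, `|expR `|w| - series (exp_coeff `|w|) n| <= d.
  by have /cvgrPdist_le := @is_cvg_series_exp_coeff R `|w|; exact.
(* The partial sums of the two series at t w, as polynomials in t; K is where the exponential tail
   at |w| falls below d. *)
exists K, (\poly_(i < K) ((~~ odd i)%:R * (-1) ^+ i./2 / i`!%:R * w ^+ i)),
  (\poly_(i < K) ((odd i)%:R * (-1) ^+ i.-1./2 / i`!%:R * w ^+ i)).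
have tw (t : R) : t \in `[-1, 1] -> `|t * w| <= `|w|.
  by rewrite in_itv/= -ler_norml normrM => t1; rewrite ler_piMl.
have tail (t : R) : t \in `[-1, 1] ->
    expR `|t * w| - series (exp_coeff `|t * w|) K <= d.
  by move=> /tw h; apply: le_trans (exp_tail _ _ K (normr_ge0 _) h) (le_trans (ler_norm _) HK).
split; [exact: size_poly|exact: size_poly| |] => t t1.
- rewrite horner_poly; apply: le_trans (tail t t1).
  rewrite [X in _ - X](_ : _ = series (cos_coeff (t * w)) K); last first.
    rewrite /series/= big_mkord; apply: eq_bigr => i _.
    rewrite /cos_coeff /= exprMn -exprnP; by move: ((~~ odd i)%:R : R) ((-1) ^+ i./2 : R) (t ^+ i) (w ^+ i) (i`!%:R^-1 : R) => *; ring.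
  apply: series_tail.
  + by rewrite unlock; exact: (@is_cvg_series_cos_coeff R (t * w)).
  + exact: is_cvg_series_exp_coeff.
  + move=> n; rewrite /exp_coeff /cos_coeff /=.
    rewrite !normrM normfV !normr_nat !normrX normrN normr1 expr1n mulr1 normrM.
    by case: odd; [rewrite !mul0r divr_ge0|rewrite mul1r].
- rewrite horner_poly; apply: le_trans (tail t t1).
  rewrite [X in _ - X](_ : _ = series (sin_coeff (t * w)) K); last first.
    rewrite /series/= big_mkord; apply: eq_bigr => i _.
    by rewrite /sin_coeff /= exprMn ?exprnP; move: ((odd i)%:R : R) ((-1) ^+ i.-1./2 : R) (t ^+ i) (w ^+ i) (i`!%:R^-1 : R) => *; ring.
  apply: series_tail.
  + by rewrite unlock; exact: (@is_cvg_series_sin_coeff R (t * w)).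
  + exact: is_cvg_series_exp_coeff.
  + move=> n; rewrite /exp_coeff /sin_coeff /=.
    rewrite !normrM normfV !normr_nat !normrX normrN normr1 expr1n mulr1 normrM.
    by case: odd; [rewrite mul1r|rewrite !mul0r divr_ge0].
Qed.

End LegendreBasis.

(** * Legendre expansion of the exponentials *)

Section Residual.
Context {R : realType}.
Notation mu := (@lebesgue_measure R).

(* The squared norm of the component of t |-> e^{itw} orthogonal to P_0, ...,
   P_{n-1} in L^2(-1, 1). *)
Definition exp_residual n (w : R) : R :=
  \int[mu]_t (residual legendreL n (cos11 w) t ^+ 2) + \int[mu]_t (residual legendreL n (sin11 w) t ^+ 2).

Definition exp_coef_bound (w : R) k : R := (k%:R + 2^-1) * (legendre_bound k ^+ 2 * w ^+ k.*2).

Lemma exp_coef_bound_ge0 w k : 0 <= exp_coef_bound w k.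
Proof.
rewrite mulr_ge0 ?addr_ge0 ?invr_ge0// mulr_ge0 ?sqr_ge0//.
by rewrite -muln2 exprM sqr_ge0.
Qed.

(** The ratio of consecutive terms is w^2 / ((2k + 1) (2k + 3)), and 4 k^2 is below that
    denominator. *)
Lemma exp_coef_boundS_le w k : `|w| <= k%:R -> 4 * exp_coef_bound w k.+1 <= exp_coef_bound w k.
Proof.
move=> wk; have w2 : w ^+ 2 <= k%:R ^+ 2.
  by rewrite -(real_normK (num_real w)) lerXn2r ?nnegrE.
have k0 : 0 <= k%:R :> R by [].
have := exp_coef_bound_ge0 w k; have p : 0 < (2 * k%:R + 1) * (2 * k%:R + 3) :> R.
  by rewrite mulr_gt0// ltr_wpDl// mulr_ge0.
have -> : exp_coef_bound w k.+1 = exp_coef_bound w k * (w ^+ 2 / ((2 * k%:R + 1) * (2 * k%:R + 3))).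
  rewrite /exp_coef_bound legendre_boundS doubleS !exprS -[k.+1%:R]natr1 !expr0 !mulr1.
  have k3 : 2 * k%:R + 3 != 0 :> R by rewrite gt_eqF// ltr_wpDl// mulr_ge0.
  have k1 : 2 * k%:R + 1 != 0 :> R by rewrite gt_eqF// ltr_wpDl// mulr_ge0.
  move: k1 k3; move: (w ^+ k.*2) (legendre_bound k) (k%:R : R) => u v z z1 z3.
  by field; apply/andP.
move=> t0; rewrite mulrCA ler_piMr// mulrA ler_pdivrMr// mul1r.
move: w2 k0; move: (w ^+ 2) (k%:R : R) => u v; nra.
Qed.

(** The decay 4 T_{k+1} <= T_k reads T_k <= (4/3) (T_k - T_{k+1}), which telescopes. *)
Lemma sum_exp_coef_bound w n m : `|w| <= n%:R ->
  \sum_(n <= k < n + m) exp_coef_bound w k <= 4 / 3 * (exp_coef_bound w n - exp_coef_bound w (n + m)).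
Proof.
move=> wn; elim: m => [|m ih]; first by rewrite addn0 big_geq// subrr mulr0.
rewrite addnS big_nat_recr ?leq_addr//=.
have : 4 * exp_coef_bound w (n + m).+1 <= exp_coef_bound w (n + m).
  by apply: exp_coef_boundS_le; rewrite (le_trans wn)// ler_nat leq_addr.
move: ih; move: (\sum_(n <= k < n + m) _) (exp_coef_bound w n) (exp_coef_bound w (n + m)) (exp_coef_bound w (n + m).+1) => *; lra.
Qed.

Lemma integral_chi_sqr_le (f g : R -> R) (d : R) : continuous f -> continuous g ->
  (forall t, t \in `[-1, 1] -> `|f t - g t| <= d) ->
  \int[mu]_t ((chi t * f t - chi t * g t) ^+ 2) <= 2 * d ^+ 2.
Proof.
move=> cf cg fg; have -> : 2 * d ^+ 2 = \int[mu]_t (d ^+ 2 * chi t).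
  rewrite integralZ'; last exact: L1_indic_itv.
  rewrite mulrC; congr (_ * _).
  under eq_Rintegral do rewrite -[chi _]mulr1; rewrite integral_chi.
  by rewrite -(@onem_sqr_int0 R); apply: eq_Rintegral => t _; rewrite expr0.
apply: integral_le'.
- by apply: L2_sqr; apply: L2B; exact: L2_chi.
- exact/L1Z/L1_indic_itv.
- move=> t; rewrite -mulrBr exprMn expr2 chi_sqr mulrC chiE.
  have [t1|_] := boolP (t \in _); last by rewrite !mulr0.
  rewrite !mulr1 -(real_normK (num_real (_ - _))) lerXn2r ?nnegrE// ?fg//.
  exact: le_trans (normr_ge0 _) (fg t t1).
Qed.

(** Beyond the degree K of a good Taylor polynomial, the residual is at most the Taylor error,
    because the polynomial lies in the span and the residual is the best approximation error. Only
    finitely many coefficients remain. *)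
Lemma exp_residual_le_sum n w (d : R) : 0 < d -> exists m,
  exp_residual n w <= d + \sum_(n <= k < n + m) exp_coef_bound w k.
Proof.
(* An error d' on an interval of length 2 costs 2 d'^2, once for the cosine and once for the sine: 4
   d'^2 = d in all. *)
move=> d0; pose d' := Num.sqrt (d / 4).
have d'0 : 0 < d' by rewrite sqrtr_gt0 divr_gt0.
have d'2 : 2 * d' ^+ 2 + 2 * d' ^+ 2 = d.
  by rewrite sqr_sqrtr ?divr_ge0 ?(ltW d0)//; field.
have [K [p [q [pK qK Hp Hq]]]] := cos_sin_poly w _ d'0.
exists K; have nK : (n <= n + K)%N by rewrite leq_addr.
have KnK : (K <= n + K)%N by rewrite leq_addl.
have e2 := @L2_legendreL R; have eO := @legendreL_orthonormal R.
rewrite /exp_residual (norm_residual_tail _ e2 eO _ _ _ (L2_cos11 w) nK).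
rewrite (norm_residual_tail _ e2 eO _ _ _ (L2_sin11 w) nK).
have [dp pE] := poly_lincomb _ _ (leq_trans pK KnK).
have [dq qE] := poly_lincomb _ _ (leq_trans qK KnK).
have hc : \int[mu]_t (residual legendreL (n + K) (cos11 w) t ^+ 2) <= 2 * d' ^+ 2.
  apply: le_trans (norm_residual_le _ e2 eO (n + K) (cos11 w) dp (L2_cos11 w)) _.
  under eq_Rintegral do rewrite -pE.
  exact: integral_chi_sqr_le (continuous_cosM w) (@continuous_horner _ p) Hp.
have hs : \int[mu]_t (residual legendreL (n + K) (sin11 w) t ^+ 2) <= 2 * d' ^+ 2.
  apply: le_trans (norm_residual_le _ e2 eO (n + K) (sin11 w) dq (L2_sin11 w)) _.
  under eq_Rintegral do rewrite -qE.
  exact: integral_chi_sqr_le (continuous_sinM w) (@continuous_horner _ q) Hq.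
rewrite addrACA -big_split/= -[X in _ <= X + _]d'2.
apply: lerD; first exact: (lerD hc hs).
by apply: ler_sum => k _; exact: coef_cos11_sin11.
Qed.

Lemma exp_residual_le n w : `|w| <= n%:R -> exp_residual n w <= 4 / 3 * exp_coef_bound w n.
Proof.
move=> wn; apply/ler_addgt0Pr => d d0.
have [m hm] := exp_residual_le_sum n w _ d0; rewrite (le_trans hm)// addrC lerD2r.
apply: le_trans (sum_exp_coef_bound _ _ _ wn) _.
by rewrite ler_wpM2l// ?divr_ge0// gerBl exp_coef_bound_ge0.
Qed.

Lemma expR1_ge2 : 2 <= expR 1 :> R.
Proof. by have := expR_ge1Dx (1 : R). Qed.

(** The induction starts at n = 1, where b_1 * 5 = 10/3, and gains one factor e per step; one factor
    e >= 2 then turns 10/3 into 5/3. At n = 0 the bound would fail, as b_0 = 2. *)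
Lemma legendre_bound_le n : (0 < n)%N -> legendre_bound n * (2 * n%:R + 3) ^+ n <= 5 / 3 * expR 1 ^+ n :> R.
Proof.
case: n => // n _; have e2 := expR1_ge2.
suff: legendre_bound n.+1 * (2 * n.+1%:R + 3) ^+ n.+1 <= 10 / 3 * expR 1 ^+ n :> R.
  move=> h; rewrite (le_trans h)// exprS.
  have : 0 <= expR 1 ^+ n :> R by rewrite exprn_ge0// expR_ge0.
  move: (expR 1 ^+ n) e2; move: (expR 1 : R) => u v *; nra.
elim: n => [|n ih].
  rewrite legendre_boundS legendre_bound0 expr0 !expr1 mulr0 add0r le_eqVlt; apply/orP; left; apply/eqP.
  by field.
rewrite legendre_boundS.
have z0 : 0 < 2 * n.+1%:R + 3 :> R by rewrite ltr_wpDl// mulr_ge0.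
have -> : 2 * n.+2%:R + 3 = (2 * n.+1%:R + 3) * (1 + 2 / (2 * n.+1%:R + 3)) :> R.
  rewrite -[n.+2%:R]natr1; have := lt0r_neq0 z0; move: (n.+1%:R : R) => z zn; by field.
rewrite exprMn [X in _ * (X * _)]exprS.
set z := 2 * n.+1%:R + 3 in z0 ih *.
have -> : legendre_bound n.+1 / z * (z * z ^+ n.+1 * (1 + 2 / z) ^+ n.+2) =
    (legendre_bound n.+1 * z ^+ n.+1) * (1 + 2 / z) ^+ n.+2.
  have := lt0r_neq0 z0; move: (z ^+ n.+1) (legendre_bound n.+1) ((1 + 2 / z) ^+ n.+2) => u v x zn.
  by field.
rewrite [expR 1 ^+ n.+1]exprSr [leRHS]mulrA ler_pM ?exprn_ge0 ?addr_ge0 ?divr_ge0 ?(ltW z0)//.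
  by rewrite mulr_ge0 ?exprn_ge0 ?(ltW z0)// ltW// legendre_bound_gt0.
(* Here z = 2n + 5 exceeds 2 (n + 2), so the exponent 2 (n + 2) / z is at most 1. *)
apply: (@le_trans _ _ (expR (2 / z) ^+ n.+2)).
  by rewrite lerXn2r ?nnegrE ?expR_ge0 ?addr_ge0 ?divr_ge0 ?(ltW z0)// expR_ge1Dx.
rewrite -expRM_natr ler_expR -mulrAC ler_pdivrMr// mul1r /z -[n.+2%:R]natr1.
move: (n.+1%:R : R) => v; lra.
Qed.

(** The left side is the integral over [-c, c] of the pointwise bound on the transform, for |g| = 1.
    The factor 2 / (2n + 1) from w^(2n) cancels n + 1/2, and the odd power c^(2n+1) leaves the
    single c whose root appears on the right. *)
Lemma exp_coef_bound_int_le n (c : R) : 0 < c -> (0 < n)%N ->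
  (2 * pi)^-1 * (4 / 3 * ((n%:R + 2^-1) * (legendre_bound n ^+ 2 * (2 * c ^+ n.*2.+1 / n.*2.+1%:R)))) <=
  (Num.sqrt c * (expR 1 * c / (2 * n%:R + 3)) ^+ n) ^+ 2.
Proof.
move=> c0 n0; have b := legendre_bound_le _ n0.
have z0 : 0 < 2 * n%:R + 3 :> R by rewrite ltr_wpDl// mulr_ge0.
have pi0 := @pi_ge2 R.
have -> : n.*2.+1%:R = 2 * (n%:R + 2^-1) :> R.
  by rewrite -natr1 -mul2n natrM mulrDr mulfV.
have h0 : n%:R + 2^-1 != 0 :> R by rewrite gt_eqF// ltr_wpDl// invr_gt0.
have -> : (n%:R + 2^-1) * (legendre_bound n ^+ 2 * (2 * c ^+ n.*2.+1 / (2 * (n%:R + 2^-1)))) =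
   legendre_bound n ^+ 2 * c ^+ n.*2.+1.
  by move: h0; move: (n%:R + 2^-1 : R) (legendre_bound n) (c ^+ n.*2.+1) => u v x *; field.
have -> : (Num.sqrt c * (expR 1 * c / (2 * n%:R + 3)) ^+ n) ^+ 2 =
    c * c ^+ n.*2 * (expR 1 ^+ n.*2 / (2 * n%:R + 3) ^+ n.*2).
  rewrite exprMn sqr_sqrtr ?(ltW c0)// -exprM muln2 exprMn exprMn exprVn.
  by move: (expR 1 ^+ _) (c ^+ _) (_ ^+ _)^-1 => u v x; ring.
rewrite [c ^+ n.*2.+1]exprS.
rewrite [leLHS](_ : _ = c * c ^+ n.*2 * ((2 * pi)^-1 * (4 / 3 * legendre_bound n ^+ 2))); last first.
  by move: (_^-1) (c ^+ _) (legendre_bound n ^+ 2) => u v x; ring.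
rewrite ler_wpM2l// ?mulr_ge0 ?exprn_ge0 ?(ltW c0)//.
rewrite ler_pdivlMr ?exprn_gt0//.
have := ltW (@legendre_bound_gt0 R n); move: b; move: (legendre_bound n) => bn b bn0.
have B : (bn * (2 * n%:R + 3) ^+ n) ^+ 2 <= (5 / 3 * expR 1 ^+ n) ^+ 2 :> R.
  rewrite lerXn2r// nnegrE; apply: mulr_ge0; first exact: bn0.
  - by rewrite exprn_ge0// ltW.
  - by rewrite divr_ge0.
  - by rewrite exprn_ge0// expR_ge0.
move: B; rewrite !exprMn -!exprM muln2 => B.
have P : (2 * pi)^-1 <= 4^-1 :> R by rewrite lef_pV2 ?posrE ?mulr_gt0 ?pi_gt0//; lra.
have X0 : 0 <= bn ^+ 2 * (2 * n%:R + 3) ^+ n.*2 :> R.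
  by rewrite mulr_ge0 ?sqr_ge0// exprn_ge0// ltW.
have E0 : 0 <= expR 1 ^+ n.*2 :> R by rewrite exprn_ge0// expR_ge0.
rewrite [leLHS](_ : _ = (2 * pi)^-1 * (4 * (3^-1 * (bn ^+ 2 * (2 * n%:R + 3) ^+ n.*2)))); last first.
  by move: (2 * pi)^-1 ((2 * n%:R + 3) ^+ n.*2) => u v; ring.
move: B X0 E0.
move: (bn ^+ 2 * (2 * n%:R + 3) ^+ n.*2) (expR 1 ^+ n.*2) => X E B X0 E0.
apply: (@le_trans _ _ (4^-1 * (4 * (3^-1 * X)))).
  by rewrite ler_wpM2r// !mulr_ge0.
rewrite mulKf//; move: B; rewrite -?exprVn; lra.
Qed.

End Residual.

(** * Fourier transform of the residual *)

Section Cut.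
Context {R : realType}.
Notation mu := (@lebesgue_measure R).
Notation Re := (@complex.Re R).
Notation Im := (@complex.Im R).
Implicit Types (f g h : R -> R[i]) (D : set R).

Definition cutoff D f (t : R) : R[i] := if t \in D then f t else 0.

Lemma C2_cutoff D f : measurable D -> C2 f -> C2 (cutoff D f).
Proof.
move=> mD [r i]; split.
  have := L2_indic _ _ mD r; congr L2; apply/funext => t.
  by rewrite /cutoff indicE /=; case: (_ \in _); rewrite ?mul1r ?mul0r.
have := L2_indic _ _ mD i; congr L2; apply/funext => t.
by rewrite /cutoff indicE /=; case: (_ \in _); rewrite ?mul1r ?mul0r.
Qed.

Lemma ip_cutoffD D f g : measurable D -> C2 f -> C2 g ->
  ip f g = ip (cutoff D f) (cutoff D g) + ip (cutoff (~` D) f) (cutoff (~` D) g).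
Proof.
move=> mD f2 g2; have mC := measurableC mD.
rewrite /ip -(integralD' _ _ (L1_ip _ _ (C2_cutoff _ _ mD f2) (C2_cutoff _ _ mD g2)) (L1_ip _ _ (C2_cutoff _ _ mC f2) (C2_cutoff _ _ mC g2))).
apply: eq_Rintegral => t _; rewrite /cutoff in_setC; case: (_ \in _) => /=.
  by rewrite !mulr0 !addr0.
by rewrite !mulr0 !add0r.
Qed.

Lemma ip_cutoff_int D f : measurable D -> ip (cutoff D f) (cutoff D f) =
  \int[mu]_(t in D) (Re (f t) * Re (f t) + Im (f t) * Im (f t)).
Proof.
move=> mD; rewrite integral_indic'//; apply: eq_Rintegral => t _.
by rewrite /cutoff indicE; case: (_ \in _); rewrite /= ?mul1r// !mul0r addr0.
Qed.

Lemma nrm_cutoff_le D f : measurable D -> C2 f -> nrm (cutoff D f) <= nrm f.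
Proof.
by move=> mD f2; rewrite ler_wsqrtr// [leRHS](ip_cutoffD _ _ _ mD f2 f2) lerDl ip_ge0.
Qed.

Lemma ip_cutoff_cmodulus D f : measurable D -> C2 f ->
  (\int[mu]_(t in D) (cmodulus (f t) ^+ 2)%:E = (ip (cutoff D f) (cutoff D f))%:E)%E.
Proof.
move=> mD f2; rewrite ip_cutoff_int// fineK.
  by apply: eq_integral => t _; rewrite cmodulus2.
apply: integrable_fin_num => //; apply: integrableS (L1_ip _ _ f2 f2) => //.
Qed.

End Cut.

Section FourierResidual.
Context {R : realType}.
Notation mu := (@lebesgue_measure R).
Notation Re := (@complex.Re R).
Notation Im := (@complex.Im R).
Implicit Types (f g h : R -> R[i]) (u v x y : R -> R) (D : set R).

Lemma residual_off n u t : t \notin `[-1, 1] -> u t = 0 -> residual legendreL n u t = 0 :> R.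
Proof.
move=> t1 ut; rewrite /residual ut /lincomb big1 ?subr0// => k _.
by rewrite /legendreL chiE (negbTE t1) mul0r mulr0.
Qed.

(** The transform at w is the pairing with [cos11 w], of which [integral_residual] keeps the
    residual only. *)
Lemma cosT_residual n u w : L2 u -> (forall t, t \notin `[-1, 1] -> u t = 0) ->
  cosT (residual legendreL n u) w = \int[mu]_t (residual legendreL n u t * residual legendreL n (cos11 w) t).
Proof.
move=> u2 u0; rewrite -(integral_residual _ (@L2_legendreL R) (@legendreL_orthonormal R) _ _ _ u2 (L2_cos11 w)).
apply: eq_Rintegral => t _; rewrite /cos11 chiE.
by have [|t1] := boolP (_ \in _); rewrite ?mul1r// (residual_off _ _ _ t1 (u0 _ t1)) !mul0r.
Qed.

Lemma sinT_residual n u w : L2 u -> (forall t, t \notin `[-1, 1] -> u t = 0) ->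
  sinT (residual legendreL n u) w = \int[mu]_t (residual legendreL n u t * residual legendreL n (sin11 w) t).
Proof.
move=> u2 u0; rewrite -(integral_residual _ (@L2_legendreL R) (@legendreL_orthonormal R) _ _ _ u2 (L2_sin11 w)).
apply: eq_Rintegral => t _; rewrite /sin11 chiE.
by have [|t1] := boolP (_ \in _); rewrite ?mul1r// (residual_off _ _ _ t1 (u0 _ t1)) !mul0r.
Qed.

(* Cauchy-Schwarz for the complex integral of g (x - iy), paired with a multiple
   of x + iy having the phase of that integral. *)
Lemma bilinear_le g x y : C2 g -> L2 x -> L2 y ->
  (\int[mu]_t (Re (g t) * x t) + \int[mu]_t (Im (g t) * y t)) ^+ 2 +
  (\int[mu]_t (Im (g t) * x t) - \int[mu]_t (Re (g t) * y t)) ^+ 2 <=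
  ip g g * (\int[mu]_t (x t ^+ 2) + \int[mu]_t (y t ^+ 2)).
Proof.
move=> g2 x2 y2; have [p2 q2] := g2.
pose h A B t : R[i] := Complex (A * x t - B * y t) (A * y t + B * x t).
have h2 A B : C2 (h A B).
  by split; [apply: L2B|apply: L2D]; exact: L2Z.
have px := L2M _ _ p2 x2; have py := L2M _ _ p2 y2.
have qx := L2M _ _ q2 x2; have qy := L2M _ _ q2 y2.
have E1 A B : ip g (h A B) =
    A * (\int[mu]_t (Re (g t) * x t) + \int[mu]_t (Im (g t) * y t)) +
    B * (\int[mu]_t (Im (g t) * x t) - \int[mu]_t (Re (g t) * y t)).
  have i1 := L1D _ _ px qy; have i2 := L1B _ _ qx py.
  rewrite -(integralD' _ _ px qy) -(integralB' _ _ qx py).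
  rewrite -(integralZ' _ _ i1) -(integralZ' _ _ i2) -(integralD' _ _ (L1Z _ _ i1) (L1Z _ _ i2)).
  apply: eq_Rintegral => t _ /=.
  by move: (Re _) (Im _) (x t) (y t) => *; ring.
have E2 A B : ip (h A B) (h A B) =
    (A ^+ 2 + B ^+ 2) * (\int[mu]_t (x t ^+ 2) + \int[mu]_t (y t ^+ 2)).
  have i := L1D _ _ (L2_sqr _ x2) (L2_sqr _ y2).
  rewrite -(integralD' _ _ (L2_sqr _ x2) (L2_sqr _ y2)) -(integralZ' _ _ i).
  apply: eq_Rintegral => t _ /=.
  by move: (x t) (y t) => *; ring.
have D0 : 0 <= \int[mu]_t (x t ^+ 2) + \int[mu]_t (y t ^+ 2).
  by rewrite addr_ge0// Rintegral_ge0// => t _; exact: sqr_ge0.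
have key (G S A B : R) : 0 <= G -> 0 <= S ->
    (A * A + B * B) ^+ 2 <= G * ((A ^+ 2 + B ^+ 2) * S) -> A ^+ 2 + B ^+ 2 <= G * S.
  rewrite -!expr2; have : 0 <= A ^+ 2 + B ^+ 2 by rewrite addr_ge0 ?sqr_ge0.
  move: (A ^+ 2 + B ^+ 2) => U + G0 S0; rewrite le_eqVlt => /predU1P[<- _|U0].
    by rewrite mulr_ge0.
  by rewrite expr2 mulrCA ler_pM2l.
by apply: (key _ _ _ _ (ip_ge0 g) D0); rewrite -E2 -E1; exact: ip_cauchy.
Qed.

Definition cresidual n u v (t : R) : R[i] := Complex (residual legendreL n u t) (residual legendreL n v t).

Variables (n : nat) (u v : R -> R).
Hypotheses (u2 : L2 u) (v2 : L2 v).
Hypothesis u0 : forall t, t \notin `[-1, 1] -> u t = 0.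
Hypothesis v0 : forall t, t \notin `[-1, 1] -> v t = 0.
Let g := cresidual n u v.

Lemma cresidual_off t : t \notin `[-1, 1] -> g t = 0.
Proof. by move=> t1; rewrite /g /cresidual (residual_off _ _ _ t1 (u0 _ t1)) (residual_off _ _ _ t1 (v0 _ t1)). Qed.

Lemma C2_cresidual : C2 g.
Proof. by split; exact: (L2_residual _ (@L2_legendreL R)). Qed.

(** [bilinear_le] is applied to the residuals of the cosine and the sine, whose squared norms add up
    to [exp_residual n w]. *)
Lemma fourier_cresidual_le w :
  Re (fourier g w) * Re (fourier g w) + Im (fourier g w) * Im (fourier g w) <=
  (2 * pi)^-1 * (ip g g * exp_residual n w).
Proof.
have g2 := C2_cresidual; have g1 := C2_supp_C1 _ _ _ g2 cresidual_off.
have resL2 := L2_residual _ (@L2_legendreL R) n.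
rewrite fourier_Re// fourier_Im//.
have -> : Re \o g = residual legendreL n u by []; have -> : Im \o g = residual legendreL n v by [].
rewrite !cosT_residual// !sinT_residual//.
have K (a b : R) : fourier_cst * a * (fourier_cst * a) + fourier_cst * b * (fourier_cst * b) = (2 * pi)^-1 * (a ^+ 2 + b ^+ 2).
  by rewrite -sqr_fourier_cst; move: fourier_cst => k; ring.
rewrite K ler_wpM2l ?invr_ge0 ?mulr_ge0 ?pi_ge0//.
exact: (bilinear_le _ _ _ g2 (resL2 _ (L2_cos11 w)) (resL2 _ (L2_sin11 w))).
Qed.

Lemma integral_monomial (c : R) : 0 < c ->
  \int[mu]_(w in `[- c, c]) (w ^+ n.*2) = 2 * c ^+ n.*2.+1 / n.*2.+1%:R.
Proof.
move=> c0; have cc : - c < c by lra.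
have m0 : n.*2.+1%:R != 0 :> R by rewrite pnatr_eq0.
pose F (x : R) := (n.*2.+1%:R^-1 *: 'X^(n.*2.+1) : {poly R}).[x].
have dF (x : R) : is_derive x (1 : R) F (x ^+ n.*2).
  apply: is_derive_eq; rewrite derivZ derivXn hornerZ hornerMn hornerXn.
  by rewrite mulr1 -[x ^+ _ *+ _]mulr_natl mulKf.
have cf : continuous (fun x : R => x ^+ n.*2) by exact: exprn_continuous.
rewrite /Rintegral (continuous_FTC2 cc (F := F))//.
- have E : (- c) ^+ n.*2.+1 = - c ^+ n.*2.+1.
    by rewrite exprNn -signr_odd /= odd_double expr1 mulN1r.
  rewrite /F /= !hornerZ !hornerXn E.
  by move: (c ^+ _) (_%:R^-1) => x y; ring.
- by apply: continuous_subspaceT.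
- exact: is_derive_LRcontinuous.
- by move=> x _; rewrite derive1E; have /@derive_val -> := dF x.
Qed.

End FourierResidual.

(** * Low frequencies of the residual and the resulting bound on its norm *)

Section Estimate.
Context {R : realType}.
Notation mu := (@lebesgue_measure R).
Notation Re := (@complex.Re R).
Notation Im := (@complex.Im R).
Implicit Types (f g h : R -> R[i]) (u v : R -> R) (D : set R).

Lemma nrm_fourier_cresidual n u v (c : R) : L2 u -> L2 v ->
  (forall t, t \notin `[-1, 1] -> u t = 0) ->
  (forall t, t \notin `[-1, 1] -> v t = 0) ->
  0 < c -> c <= n%:R -> (0 < n)%N ->
  nrm (cutoff `[- c, c]%classic (fourier (cresidual n u v))) <=
  Num.sqrt c * (expR 1 * c / (2 * n%:R + 3)) ^+ n * nrm (cresidual n u v).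
Proof.
move=> u2 v2 u0 v0 c0 cn n0.
have g2 := C2_cresidual n _ _ u2 v2.
have g1 := C2_supp_C1 _ _ _ g2 (cresidual_off n _ _ u0 v0).
have G2 := C2_fourier _ g1 g2.
have z0 : 0 < 2 * n%:R + 3 :> R by rewrite ltr_wpDl// mulr_ge0.
rewrite -(@ler_pXn2r _ 2) ?nnegrE ?nrm_ge0//; last first.
  rewrite mulr_ge0 ?nrm_ge0// mulr_ge0 ?sqrtr_ge0// exprn_ge0//.
  by rewrite mulr_ge0 ?invr_ge0 ?(ltW z0)// mulr_ge0 ?expR_ge0// ltW.
rewrite exprMn !sqr_nrm; apply: (@le_trans _ _ (_ * _)); last first.
  by apply: ler_wpM2r; [exact: ip_ge0|exact: exp_coef_bound_int_le].
have gg := ip_ge0 (cresidual n u v).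
(* Everything in the pointwise bound except the factor w^(2n). *)
pose M := (2 * pi)^-1 * (4 / 3 * ((n%:R + 2^-1) * legendre_bound n ^+ 2)) * ip (cresidual n u v) (cresidual n u v).
have ix : mu.-integrable `[- c, c] (EFin \o (fun x => x ^+ n.*2)).
  apply: continuous_compact_integrable; first exact: segment_compact.
  by apply: continuous_subspaceT; exact: exprn_continuous.
rewrite ip_cutoff_int// [leRHS](_ : _ = M * \int[mu]_(w in `[- c, c]) (w ^+ n.*2)); last first.
  rewrite integral_monomial// /M.
  by move: (2 * pi)^-1 (legendre_bound n) (ip _ _) (c ^+ _) (n%:R + 2^-1) (_ / 3) => *; ring.
rewrite -RintegralZl//; apply: le_Rintegral => //.
- by apply: integrableS (L1_ip _ _ G2 G2).
- exact: (integrableZl _ M ix).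
move=> w; rewrite /= in_itv/= -ler_norml => wc.
apply: le_trans (fourier_cresidual_le n _ _ u2 v2 u0 v0 w) _.
have := exp_residual_le _ _ (le_trans wc cn); rewrite /M /exp_coef_bound.
move: (exp_residual n w) (ip _ _) gg => d G G0 h.
apply: (@le_trans _ _ ((2 * pi)^-1 * (G * (4 / 3 * ((n%:R + 2^-1) * (legendre_bound n ^+ 2 * w ^+ n.*2)))))).
  by rewrite ler_wpM2l ?invr_ge0 ?mulr_ge0 ?pi_ge0// ler_wpM2l.
by rewrite le_eqVlt; apply/orP; left; apply/eqP;
  move: (2 * pi)^-1 (legendre_bound n) (w ^+ _) (n%:R + 2^-1) (4 / 3) => *; ring.
Qed.

(** By Parseval |g|^2 is the pairing of [fhat] with the transform of g. Below c the second factor is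
    small, above c the first one is; both bounds contain |f| |g|, and |g| is divided out. *)
Lemma nrm_cresidual_le n u v (c epsO : R) f fhat : L2 u -> L2 v ->
  (forall t, t \notin `[-1, 1] -> u t = 0) ->
  (forall t, t \notin `[-1, 1] -> v t = 0) ->
  0 < c -> c <= n%:R -> (0 < n)%N -> 0 <= epsO -> is_fourierL2 f fhat ->
  ip f (cresidual n u v) = ip (cresidual n u v) (cresidual n u v) ->
  nrm (cutoff (~` `[- c, c]%classic) fhat) <= epsO * nrm f ->
  nrm (cresidual n u v) <=
    (epsO + Num.sqrt c * (expR 1 * c / (2 * n%:R + 3)) ^+ n) * nrm f.
Proof.
move=> u2 v2 u0 v0 c0 cn n0 e0 Ff fgg freq.
have low := nrm_fourier_cresidual n _ _ _ u2 v2 u0 v0 c0 cn n0.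
have g2 := C2_cresidual n _ _ u2 v2; have goff := cresidual_off n _ _ u0 v0.
have g1 := C2_supp_C1 _ _ _ g2 goff.
have G2 := C2_fourier _ g1 g2.
have [f2 F2 _] := fourierL2_approx _ _ Ff.
have par := fourierL2_parseval _ _ _ _ _ Ff g2 goff.
have mD : measurable `[- c, c]%classic by exact: measurable_itv.
have mC := measurableC mD.
have bes : nrm (fourier (cresidual n u v)) <= nrm (cresidual n u v).
  by rewrite ler_wsqrtr// bessel_complex.
have FG := ip_cutoffD _ _ _ mD F2 G2; rewrite par fgg -sqr_nrm in FG.
have A := normr_ip_le _ _ (C2_cutoff _ _ mD F2) (C2_cutoff _ _ mD G2).
have B := normr_ip_le _ _ (C2_cutoff _ _ mC F2) (C2_cutoff _ _ mC G2).
have A' := le_trans (ler_norm _) A; have B' := le_trans (ler_norm _) B.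
have h1 := le_trans (nrm_cutoff_le _ _ mD F2) (fourierL2_nrm _ _ Ff).
have h2 := le_trans (nrm_cutoff_le _ _ mC G2) bes.
have K0 : 0 <= Num.sqrt c * (expR 1 * c / (2 * n%:R + 3)) ^+ n.
  rewrite mulr_ge0 ?sqrtr_ge0// exprn_ge0// mulr_ge0 ?invr_ge0 ?addr_ge0 ?mulr_ge0 ?expR_ge0//.
  exact: ltW.
have {}A' := le_trans A' (ler_pM (nrm_ge0 _) (nrm_ge0 _) h1 low).
have {}B' := le_trans B' (ler_pM (nrm_ge0 _) (nrm_ge0 _) freq h2).
have := nrm_ge0 (cresidual n u v); rewrite le_eqVlt => /predU1P[<-|g0].
  by rewrite mulr_ge0 ?nrm_ge0// addr_ge0.
rewrite -(ler_pM2r g0) -expr2 FG (le_trans (lerD A' B'))//.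
by move: (Num.sqrt c * _) (nrm f) (nrm _) => x y z; rewrite le_eqVlt; apply/orP; left; apply/eqP; ring.
Qed.

End Estimate.

(** * Legendre projection *)

Section Projection.
Context {R : realType}.
Notation mu := (@lebesgue_measure R).
Notation Re := (@complex.Re R).
Notation Im := (@complex.Im R).
Implicit Types (f g h : R -> R[i]) (a : R -> R) (t : R).

Lemma integral_oo_cc a : measurable_fun setT a ->
  \int[mu]_(t in `]-1, 1[) a t = \int[mu]_(t in `[-1, 1]) a t.
Proof.
move=> ma; rewrite /Rintegral (@integral_itv_bndoo R (-1) 1 (EFin \o a) true false)//.
by apply/measurable_EFinP; exact: measurable_funTS.
Qed.

(** The left side is the form in which [legendre_proj] computes its coefficients: an open indicator
    inside an integral over the closed interval. *)
Lemma coef_oo a k : L2 a ->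
  \int[mu]_(t in `[-1, 1])
    (\1_(`]-1, 1[%classic) t * a t * (Num.sqrt (k%:R + 2^-1) * (legendre R k).[t])) =
  coef legendreL (fun t => chi t * a t) k.
Proof.
move=> [ma _]; have mW : measurable_fun setT
    (fun t => Num.sqrt (k%:R + 2^-1) * (legendre R k).[t]).
  by apply: continuous_measurable_fun; exact: continuous_legendreL.
have maW := measurable_funM ma mW.
rewrite -integral_oo_cc; last first.
  apply: measurable_funM => //; exact: measurable_funM.
rewrite (_ : coef _ _ _ = \int[mu]_(t in `[-1, 1])
    (a t * (Num.sqrt (k%:R + 2^-1) * (legendre R k).[t]))).
  rewrite -integral_oo_cc; last by [].
  by apply: eq_Rintegral => t; rewrite indicE => ->; rewrite mul1r.
rewrite -integral_chi; apply: eq_Rintegral => t _.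
by rewrite /legendreL mulrACA chi_sqr.
Qed.

Definition Re11 f t := chi t * Re (f t).
Definition Im11 f t := chi t * Im (f t).

Lemma inner11E f k : C2 f -> inner11 (fun s => ind11 s * f s) (@legendreN R k) =
  Complex (coef legendreL (Re11 f) k) (coef legendreL (Im11 f) k).
Proof.
move=> [r i]; rewrite -(coef_oo _ _ r) -(coef_oo _ _ i) /inner11 /cintegral.
congr Complex; apply: eq_Rintegral => t _ /=; rewrite /ind11 /legendreN /=;
  case: (f t) => x y /=; move: (\1_ _ _) (Num.sqrt _ * _) => p q; ring.
Qed.

Lemma legendre_projE N f t : C2 f -> legendre_proj N f t =
  Complex (\1_(`]-1, 1[%classic) t * lincomb legendreL (coef legendreL (Re11 f)) N.+1 t)
          (\1_(`]-1, 1[%classic) t * lincomb legendreL (coef legendreL (Im11 f)) N.+1 t).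
Proof.
move=> f2; have chiI (x : R) : \1_(`]-1, 1[%classic) t * (chi t * x) = \1_(`]-1, 1[%classic) t * x.
  rewrite chiE indicE mem_setE; have [t1|] := boolP (t \in `]-1, 1[); last by rewrite !mul0r.
  by rewrite (subset_itv_oo_cc t1) mul1r.
rewrite /legendre_proj [LHS](_ : _ = Complex (Re (legendre_proj N f t)) (Im (legendre_proj N f t))).
  rewrite /legendre_proj; congr Complex.
    rewrite (big_morph _ (@ReD R) (erefl _)) /lincomb mulr_sumr; apply: eq_bigr => k _.
    rewrite inner11E//= [RHS]mulrCA /legendreL chiI.
    by move: (coef _ _ _) (coef _ _ _) (\1_ _ _) (Num.sqrt _) => *; ring.
  rewrite (big_morph _ (@ImD R) (erefl _)) /lincomb mulr_sumr; apply: eq_bigr => k _.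
  rewrite inner11E//= [RHS]mulrCA /legendreL chiI.
  by move: (coef _ _ _) (coef _ _ _) (\1_ _ _) (Num.sqrt _) => *; ring.
by rewrite /legendre_proj; case: (\sum_(_ <= _ < _) _).
Qed.

Lemma L2_Re11 f : C2 f -> L2 (Re11 f). Proof. by move=> [r i]; exact: L2_indic. Qed.
Lemma L2_Im11 f : C2 f -> L2 (Im11 f). Proof. by move=> [r i]; exact: L2_indic. Qed.

Lemma C2_legendre_proj N f : C2 f -> C2 (legendre_proj N f).
Proof.
move=> f2; split.
  rewrite (_ : _ \o _ = fun t => \1_(`]-1, 1[%classic) t * lincomb legendreL (coef legendreL (Re11 f)) N.+1 t).
    by apply: L2_indic => //; exact: (L2_lincomb _ (@L2_legendreL R)).
  by apply/funext => t; rewrite /= legendre_projE.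
rewrite (_ : _ \o _ = fun t => \1_(`]-1, 1[%classic) t * lincomb legendreL (coef legendreL (Im11 f)) N.+1 t).
  by apply: L2_indic => //; exact: (L2_lincomb _ (@L2_legendreL R)).
by apply/funext => t; rewrite /= legendre_projE.
Qed.

Lemma sub_proj_in N f t : C2 f -> t \in `]-1, 1[ ->
  f t - legendre_proj N f t = cresidual N.+1 (Re11 f) (Im11 f) t.
Proof.
move=> f2 t1; rewrite legendre_projE// /cresidual /residual /Re11 /Im11 indicE mem_setE t1.
by rewrite chiE (subset_itv_oo_cc t1) !mul1r; case: (f t).
Qed.

Lemma sub_proj_off N f t : C2 f -> t \notin `]-1, 1[ ->
  f t - legendre_proj N f t = f t.
Proof.
move=> f2 t1; rewrite legendre_projE// indicE mem_setE (negbTE t1) !mul0r.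
by rewrite [X in _ - X](_ : _ = 0) ?subr0.
Qed.

Lemma Re11_off f t : t \notin `[-1, 1] -> Re11 f t = 0.
Proof. by move=> t1; rewrite /Re11 chiE (negbTE t1) mul0r. Qed.

Lemma Im11_off f t : t \notin `[-1, 1] -> Im11 f t = 0.
Proof. by move=> t1; rewrite /Im11 chiE (negbTE t1) mul0r. Qed.

(** The residual is supported in [-1, 1] and orthogonal to the projection, so of f only the residual
    itself contributes. *)
Lemma ip_cresidual n f : C2 f -> ip f (cresidual n (Re11 f) (Im11 f)) =
  ip (cresidual n (Re11 f) (Im11 f)) (cresidual n (Re11 f) (Im11 f)).
Proof.
move=> f2; have [u2 v2] := (L2_Re11 _ f2, L2_Im11 _ f2).
have [p2 q2] := C2_cresidual n _ _ u2 v2.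
rewrite [RHS]/ip (integralD' _ _ (L2M _ _ p2 p2) (L2M _ _ q2 q2)).
rewrite -!(integral_residual _ (@L2_legendreL R) (@legendreL_orthonormal R))//.
rewrite -(integralD' _ _ (L2M _ _ p2 u2) (L2M _ _ q2 v2)).
apply: eq_Rintegral => t _ /=; rewrite /Re11 /Im11 mulrC (mulrC (Im _)) chiE.
have [t1|t1] := boolP (t \in _); first by rewrite !mul1r.
by rewrite (residual_off _ _ _ t1 (Re11_off _ _ t1)) (residual_off _ _ _ t1 (Im11_off _ _ t1)) !mul0r.
Qed.

Lemma integral_sub_proj N f : C2 f ->
  \int[mu]_(t in `]-1, 1[) (Re (f t - legendre_proj N f t) * Re (f t - legendre_proj N f t)
    + Im (f t - legendre_proj N f t) * Im (f t - legendre_proj N f t)) =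
  nrm (cresidual N.+1 (Re11 f) (Im11 f)) ^+ 2.
Proof.
move=> f2; have [u2 v2] := (L2_Re11 _ f2, L2_Im11 _ f2).
have g2 := C2_cresidual N.+1 _ _ u2 v2; set g := cresidual _ _ _ in g2 *.
transitivity (\int[mu]_(t in `]-1, 1[) (Re (g t) * Re (g t) + Im (g t) * Im (g t))).
  by apply: eq_Rintegral => t; rewrite mem_setE => t1; rewrite sub_proj_in.
rewrite integral_oo_cc; last first.
  by apply: L1_measurable; exact: L1_ip.
rewrite integral_indic'// sqr_nrm; apply: eq_Rintegral => t _.
rewrite indicE mem_setE; have [t1|t1] := boolP (t \in `[-1, 1]); rewrite ?mul1r//.
by rewrite /g (cresidual_off _ _ _ (Re11_off _) (Im11_off _)) //= !mul0r addr0.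
Qed.

End Projection.

Theorem theorem3p3 (R : realType) (c epsT epsO : R) (f fhat : R -> R[i])
  (c_gt0 : 0 < c) (epsT_gt0 : 0 < epsT) (epsO_gt0 : 0 < epsO)
  (f_L2 : memLp 2%:E f)
  (f_fhat : is_fourierL2 f fhat)
  (time_conc :
    (\int[@lebesgue_measure R]_(t in [set t : R | (1 < `|t|)%R])
        (cmodulus (f t) ^+ 2)%:E
      <= (epsT ^+ 2)%:E * L2norm setT f ^+ 2)%E)
  (freq_conc :
    (\int[@lebesgue_measure R]_(w in [set w : R | (c < `|w|)%R])
        (cmodulus (fhat w) ^+ 2)%:E
      <= (epsO ^+ 2)%:E * L2norm setT f ^+ 2)%E) :
  forall N : nat, expR 1 * c / 2 <= N%:R ->
    (L2norm `](-1)%R, 1%R[ (f \- legendre_proj N f)%R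
       <= (2 * epsO
           + Num.sqrt c * (expR 1 * c / (2 * N%:R + 5)) ^+ N.+1)%:E
          * L2norm setT f)%E /\
    (L2norm setT (f \- legendre_proj N f)%R
       <= (epsT + 2 * epsO
           + Num.sqrt c * (expR 1 * c / (2 * N%:R + 5)) ^+ N.+1)%:E
          * L2norm setT f)%E.
Proof.
move=> N cN; have [f2 F2 _] := fourierL2_approx _ _ f_fhat.
have [u2 v2] := (L2_Re11 _ f2, L2_Im11 _ f2).
have ext (r : R) : [set x : R | r < `|x|] = ~` `[- r, r]%classic.
  by apply/seteqP; split=> x /=; rewrite in_itv/= -ler_norml ltNge => /negP.
have mI (r : R) : measurable (~` `[- r, r]%classic) by apply: measurableC; exact: measurable_itv.
have conc (e r : R) h : 0 < e -> C2 h ->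
    (\int[lebesgue_measure]_(t in [set t : R | (r < `|t|)%R]) (cmodulus (h t) ^+ 2)%:E
      <= (e ^+ 2)%:E * L2norm setT f ^+ 2)%E ->
    nrm (cutoff (~` `[- r, r]%classic) h) <= e * nrm f.
  move=> e0 h2; rewrite ext ip_cutoff_cmodulus// L2norm_nrm//.
  rewrite -EFin_expe -EFinM lee_fin => le.
  rewrite -(@ler_pXn2r _ 2) ?nnegrE ?nrm_ge0//.
    by rewrite sqr_nrm exprMn.
  by rewrite mulr_ge0 ?nrm_ge0// ltW.
have tc := conc _ _ _ epsT_gt0 f2 time_conc; have fc := conc _ _ _ epsO_gt0 F2 freq_conc.
(* Since e >= 2, the hypothesis gives c <= ec/2 <= N. *)
have cn : c <= N.+1%:R.
  rewrite -[N.+1%:R]natr1; move: cN; have := @expR1_ge2 R.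
  move: (expR 1) (N%:R : R) => x y; nra.
have z0 : 0 < 2 * N%:R + 5 :> R by rewrite ltr_wpDl// mulr_ge0.
have := nrm_cresidual_le N.+1 _ _ _ _ _ _ u2 v2 (Re11_off f) (Im11_off f) c_gt0 cn isT (ltW epsO_gt0)
  f_fhat (ip_cresidual N.+1 _ f2) fc.
have -> : 2 * N.+1%:R + 3 = 2 * N%:R + 5 :> R by rewrite -[N.+1%:R]natr1; ring.
have K0 : 0 <= Num.sqrt c * (expR 1 * c / (2 * N%:R + 5)) ^+ N.+1.
  rewrite mulr_ge0 ?sqrtr_ge0// exprn_ge0// mulr_ge0 ?invr_ge0 ?(ltW z0)//.
  by rewrite mulr_ge0 ?expR_ge0// ltW.
move: (Num.sqrt c * _) K0 => K K0 est.
have D2 := C2B _ _ f2 (C2_legendre_proj N _ f2).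
have g0 := nrm_ge0 (cresidual N.+1 (Re11 f) (Im11 f)).
have E := integral_sub_proj N _ f2.
rewrite !L2norm_nrm// -!EFinM; split.
  rewrite L2normE -[X in (X `^ _)%E]fineK; last first.
    apply: integrable_fin_num => //; exact: integrableS (L1_ip _ _ D2 D2).
  have -> : forall x, x = nrm (cresidual N.+1 (Re11 f) (Im11 f)) ^+ 2 ->
     ((x%:E `^ 2^-1) = (nrm (cresidual N.+1 (Re11 f) (Im11 f)))%:E)%E.
    by move=> x ->; rewrite poweR_EFin powR12_sqrt ?sqr_ge0// sqrtr_sqr ger0_norm.
    rewrite lee_fin (le_trans est)// ler_wpM2r ?nrm_ge0//.
    by move: K0; lra.
  exact: E.
rewrite lee_fin; set D := f \- _ in D2 *.
have mJ : measurable `[- 1, 1 : R]%classic by exact: measurable_itv.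
(* Outside [-1, 1] the projection vanishes and D is f, so the time concentration controls the second
   square. *)
have S : nrm D ^+ 2 = nrm (cresidual N.+1 (Re11 f) (Im11 f)) ^+ 2 +
    nrm (cutoff (~` `[- 1, 1]%classic) f) ^+ 2.
  rewrite sqr_nrm (ip_cutoffD _ _ _ mJ D2 D2); congr (_ + _).
    rewrite ip_cutoff_int// -E integral_oo_cc//.
    by apply: L1_measurable; exact: L1_ip.
  rewrite sqr_nrm; congr ip; apply/funext => t; rewrite /cutoff in_setC mem_setE;
    case: ifPn => // t1; rewrite /D /= sub_proj_off//;
    by apply: contra t1; exact: subset_itv_oo_cc.
(* The root of a sum of two squares is at most the sum of the roots. *)
rewrite (@le_trans _ _ (nrm (cresidual N.+1 (Re11 f) (Im11 f)) + nrm (cutoff (~` `[- 1, 1]%classic) f)))//.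
  rewrite -(@ler_pXn2r _ 2) ?nnegrE ?addr_ge0 ?nrm_ge0// S sqrrD lerD2r lerDl.
  by rewrite mulrn_wge0// mulr_ge0 ?nrm_ge0.
rewrite (le_trans (lerD est tc))// -mulrDl ler_wpM2r ?nrm_ge0//.
by move: K0 epsO_gt0; lra.
Qed.
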